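(* Let $\boldsymbol\epsilon=\{\boldsymbol\epsilon_j\in\mathbb{R}^n: j=1,\dots,T\}$ be a finite set of prediction error outcomes, let $\hat{\boldsymbol y}_t\in\mathbb{R}^n$ be the predicted asset returns, let $\gamma\in\mathbb{R}_+$ be the risk appetite parameter, and let $\mathcal{Z}=\{\boldsymbol z\in\mathbb{R}^n:\boldsymbol z\ge\boldsymbol 0,\ \boldsymbol 1^\top\boldsymbol z=1\}$. Let $f_{\boldsymbol\epsilon}(\boldsymbol z,\boldsymbol p)$ be the deviation risk measure and let $\mathcal{P}(\delta)$ be the ambiguity set with size parameter $\delta$, both as defined in the context. Then, by convex duality, the minimax problem $$\boldsymbol z_t^*=\operatorname*{argmin}_{\boldsymbol z\in\mathcal{Z}}\ \max_{\boldsymbol p\in\mathcal{P}(\delta)}\ f_{\boldsymbol\epsilon}(\boldsymbol z,\boldsymbol p)-\gamma\cdot\hat{\boldsymbol y}_t^\top\boldsymbol z$$ can be reformulated as the minimization problem $$\boldsymbol z_t^*=\operatorname*{argmin}_{\boldsymbol z\in\mathcal{Z},\ \lambda\ge 0,\ \xi,\ c}\ f^{\delta}_{\boldsymbol\epsilon}(\boldsymbol z,c,\lambda,\xi)-\gamma\cdot\hat{\boldsymbol y}_t^\top\boldsymbol z ,$$ where $\xi,c\in\mathbb{R}$, only the $\boldsymbol z$-component of the minimizer is retained as output, and $$f^{\delta}_{\boldsymbol\epsilon}(\boldsymbol z,c,\lambda,\xi)=\xi+\delta\cdot\lambda+\frac{\lambda}{T}\sum_{j=1}^T\phi^*\!\left(\frac{R(\boldsymbol\epsilon_j^\top\boldsymbol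 z-c)-\xi}{\lambda}\right),$$ with $\phi^*$ the convex conjugate of the function $\phi$ defining the $\phi$-divergence in $\mathcal{P}(\delta)$. That is, the two problems are equivalent: $$\min_{\boldsymbol z\in\mathcal{Z},\,c}\ \max_{\boldsymbol p\in\mathcal{P}(\delta)}\sum_{j=1}^T p_j\cdot R(\boldsymbol\epsilon_j^\top\boldsymbol z-c)-\gamma\cdot\hat{\boldsymbol y}_t^\top\boldsymbol z\iff\min_{\boldsymbol z\in\mathcal{Z},\ \lambda\ge0,\ \xi,\ c} f^{\delta}_{\boldsymbol\epsilon}(\boldsymbol z,c,\lambda,\xi)-\gamma\cdot\hat{\boldsymbol y}_t^\top\boldsymbol z,$$ where, for each fixed $\boldsymbol z\in\mathcal{Z}$, $\max_{\boldsymbol p\in\mathcal{P}(\delta)}f_{\boldsymbol\epsilon}(\boldsymbol z,\boldsymbol p)=\min_{c\in\mathbb{R}}\max_{\boldsymbol p\in\mathcal{P}(\delta)}\sum_{j=1}^T p_j\cdot R(\boldsymbol\epsilon_j^\top\boldsymbol z-c)$.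
   Context: $R:\mathbb{R}\to\mathbb{R}_+\cup\{+\infty\}$ is a closed convex function with $R(0)=0$ and $R(X)=R(-X)$. Probability simplex: $\mathcal{Q}=\{\boldsymbol p\in\mathbb{R}^T:\boldsymbol p\ge\boldsymbol 0,\ \boldsymbol 1^\top\boldsymbol p=1\}$. The nominal distribution $\boldsymbol q\in\mathcal{Q}$ is uniform: $q_j=1/T$ for all $j$. Deviation risk measure: $f_{\boldsymbol\epsilon}(\boldsymbol z,\boldsymbol p)=\min_{c}\sum_{j=1}^T p_j\cdot R(\boldsymbol\epsilon_j^\top\boldsymbol z-c)$ for $\boldsymbol z\in\mathcal{Z}$, $\boldsymbol p\in\mathcal{Q}$. Statistical distance: $I_\phi(\boldsymbol p,\boldsymbol q)=\sum_{j=1}^T q_j\cdot\phi(p_j/q_j)$, a map $\mathcal{Q}\times\mathcal{Q}\to\mathbb{R}_+$ based on a $\phi$-divergence (e.g. Kullback–Leibler, Hellinger, chi-squared). The convex conjugate is $\phi^*(w)=\max_{s\ge0}\{s\,w-\phi(s)\}$, and $(\lambda\phi)^*(w)=\lambda\cdot\phi^*(w/\lambda)$ is used for $\lambda\ge0$. Ambiguity set: $\mathcal{P}(\delta)=\{\boldsymbol p\in\mathbb{R}^T:\boldsymbol p\ge\boldsymbol 0,\ \boldsymbol 1^\top\boldsymbol p=1,\ I_\phi(\boldsymbol p,\boldsymbol q)\le\delta\}$; the size parameter $\delta$ is the maximum permissible distance between $\boldsymbol p$ and $\boldsymbol q$. The auxiliary variables $\lambda\ge0$ and $\xi\in\mathbb{R}$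 are the Lagrange multipliers of the constraints $I_\phi(\boldsymbol p,\boldsymbol q)\le\delta$ and $\boldsymbol 1^\top\boldsymbol p=1$, respectively.
   Formalization: Equality of optimal values is stated for all δ ≥ 0, but the identity of the argmins with a minimizing (λ, ξ) only for δ > 0, since at δ = 0 the dual minimum need not be attained (e.g. KL); the maxima over p are suprema, shown attained when φ is closed. *)

(* Defs.v *)
From HB Require Import structures.
From mathcomp Require Import all_boot all_order all_algebra.
From mathcomp Require Import all_classical all_reals all_analysis.

Set Implicit Arguments.
Unset Strict Implicit.
Unset Printing Implicit Defensive.

Import Order.TTheory GRing.Theory Num.Theory.
Import numFieldNormedType.Exports.

Local Open Scope classical_set_scope.
Local Open Scope ring_scope.

(* Everything is extended-real valued, with the library's convention
   0 * +oo = 0: an outcome of probability 0 does not contribute to a risk,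
   even where the deviation function is +oo. *)

Section Optimization.
Context {R : realType} {U : Type}.
Implicit Types (A : set U) (F : U -> \bar R).

Definition min_value A F : \bar R := ereal_inf [set F x | x in A].
Definition max_value A F : \bar R := ereal_sup [set F x | x in A].

(* [argmin A F !=set0] says that [min_value A F] is attained on A; if F is
   constantly +oo on A, every point of A is a minimizer. *)
Definition argmin A F : set U :=
  [set x | A x /\ forall y, A y -> (F x <= F y)%E].
Definition argmax A F : set U :=
  [set x | A x /\ forall y, A y -> (F y <= F x)%E].

End Optimization.

Section ConvexFunctions.
Context {R : realType}.
Implicit Types (g phi : R -> \bar R).

Definition econvex g := forall (x y t : R), 0 <= t <= 1 ->
  (g (t * x + (1 - t) * y)%R <= t%:E * g x + (1 - t)%:E * g y)%E.

(* A closed convex function R -> [0, +oo], vanishing at 0 and even. *)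
Definition deviation_function g :=
  [/\ forall x, (0 <= g x)%E, econvex g, lower_semicontinuous g,
      g 0 = 0%E & forall x, g (- x) = g x].

(* The generator of a phi-divergence is a convex function on [0, +oo[ with
   phi 1 = 0, extended by +oo to the negative reals. It is finite on ]0, +oo[;
   phi 0 = +oo is permitted (as for phi s = (s - 1)^2 / s). The divergence is
   nonnegative on the simplex by Jensen's inequality. *)
Definition divergence_generator phi :=
  [/\ econvex phi, phi 1 = 0%E, forall s, 0 < s -> phi s \is a fin_num
    & forall s, s < 0 -> phi s = +oo%E].

(* The argument w may be +oo, because the loss it is applied to may be. *)
Definition conjugate phi (w : \bar R) : \bar R :=
  max_value [set s | 0 <= s] (fun s => (s%:E * w - phi s)%E).

(* lam * phi^*(w / lam) for lam > 0. At lam = 0 the quotient has no meaning and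
   the value is the one prescribed by (lam phi)^*(w) = lam * phi^*(w / lam):
   it is (0 phi)^*(w), i.e. 0 for w <= 0 and +oo for w > 0. *)
Definition scaled_conjugate phi (lam : R) (w : \bar R) : \bar R :=
  if 0 < lam then (lam%:E * conjugate phi (w * (lam^-1)%:E))%E
  else conjugate (fun s => (lam%:E * phi s)%E) w.

End ConvexFunctions.

Section Portfolio.
Context {R : realType}.

Definition dot n (u v : 'cV[R]_n) : R := (u^T *m v) 0 0.

Definition simplex n : set 'cV[R]_n :=
  [set u | (forall i, 0 <= u i 0) /\ \sum_i u i 0 = 1].

Definition uniform T : 'cV[R]_T := const_mx (T%:R^-1).

Definition divergence T (phi : R -> \bar R) (p q : 'cV[R]_T) : \bar R :=
  (\sum_(j < T) (q j 0%R)%:E * phi (p j 0 / q j 0)%R)%E.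

Definition ambiguity_set T (phi : R -> \bar R) (delta : R) : set 'cV[R]_T :=
  [set p | simplex p /\ (divergence phi p (uniform T) <= delta%:E)%E].

Section Objectives.
Context {n T : nat}.
Variables (eps : 'I_T -> 'cV[R]_n) (yhat : 'cV[R]_n) (gamma delta : R).
Variables (dev phi : R -> \bar R).

Definition centered_risk (z : 'cV[R]_n) (c : R) (p : 'cV[R]_T) : \bar R :=
  (\sum_(j < T) (p j 0%R)%:E * dev (dot (eps j) z - c)%R)%E.

Definition deviation_risk (z : 'cV[R]_n) (p : 'cV[R]_T) : \bar R :=
  min_value setT (fun c : R => centered_risk z c p).

Definition robust_risk (z : 'cV[R]_n) : \bar R :=
  max_value (ambiguity_set phi delta) (deviation_risk z).

Definition robust_centered_risk (z : 'cV[R]_n) (c : R) : \bar R :=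
  max_value (ambiguity_set phi delta) (centered_risk z c).

Definition dual_risk (z : 'cV[R]_n) (c lam xi : R) : \bar R :=
  (xi%:E + (delta * lam)%:E + (T%:R^-1)%:E *
     \sum_(j < T) scaled_conjugate phi lam
                    (dev (dot (eps j) z - c)%R - xi%:E))%E.

Definition reward (z : 'cV[R]_n) : \bar R := (gamma * dot yhat z)%:E.

Definition minimax_objective (z : 'cV[R]_n) : \bar R :=
  (robust_risk z - reward z)%E.

Definition joint_objective (x : 'cV[R]_n * R) : \bar R :=
  let: (z, c) := x in (robust_centered_risk z c - reward z)%E.

Definition dual_objective (x : 'cV[R]_n * R * R * R) : \bar R :=
  let: (z, c, lam, xi) := x in (dual_risk z c lam xi - reward z)%E.

End Objectives.

Definition joint_feasible n : set ('cV[R]_n * R) :=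
  [set x | simplex x.1].

Definition dual_feasible n : set ('cV[R]_n * R * R * R) :=
  [set x | let: (z, c, lam, xi) := x in simplex z /\ 0 <= lam].

End Portfolio.

(* Main.v *)
Require Import Defs.
From HB Require Import structures.
From mathcomp Require Import all_boot all_order all_algebra.
From mathcomp Require Import all_classical all_reals all_analysis.
From mathcomp Require Import perm ring lra.

Set Implicit Arguments.
Unset Strict Implicit.
Unset Printing Implicit Defensive.

Import Order.TTheory GRing.Theory Num.Theory.
Import numFieldNormedType.Exports.

Local Open Scope classical_set_scope.
Local Open Scope ring_scope.

(* For a fixed portfolio, the risk is affine in the weights [p] and convex and
   lower semicontinuous in the center [c], and projecting [c] onto a bounded
   interval that contains all the outcomes lowers it. So the minimum over [c]
   may be taken on a compact interval. Minimax: if the closed intervals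
   [{c | risk c p <= b}], for [p] positive, intersect pairwise, then they have a
   common point; otherwise two of them are disjoint, and a separation in the
   plane gives a mixture of the two weights whose risk is nowhere below [b].

   For a fixed [c], the same planar separation gives the multiplier [lambda] of
   the divergence constraint (on positive weights in the simplex, the uniform
   weights being a Slater point if [delta > 0]) and then the multiplier [xi] of
   the normalization (on all positive weights); the remaining supremum separates
   into conjugates. For [delta = 0] there is no Slater point, and compactness
   gives multipliers up to an arbitrarily small error. *)

(** Positive weights are singled out for two reasons. A generator is finite on []0, +oo[] but may be
    [+oo] at 0, so on positive weights the divergence is a real number and separation takes place in
    the real plane; the boundary is recovered afterwards, by convexity of [phi] at 0 in the
    conjugate and by mixing with the uniform weights in the minimax. Moreover, a finite risk at
    positive weights forces every loss to be finite, so all positive weights have the same centers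
    of finite risk. Infinite losses disappear from the duality at once: the uniform weights are
    feasible and charge every outcome, so a single infinite loss makes both sides [+oo]. The planar
    lemma asks for points on both sides of the axis. This is where a Slater point, weights of total
    mass below and above 1, and a strict gap between two risk levels enter. *)

Section Separation.
Variable R : realType.

(* The slope is the supremum of [b / a] over the points of [S] on the left of
   the vertical axis. *)
Lemma convex_support_slope (S : set (R * R)) :
  (forall a b a' b' t, S (a, b) -> S (a', b') -> 0 <= t <= 1 ->
     S (t * a + (1 - t) * a', t * b + (1 - t) * b')) ->
  (forall b, S (0, b) -> 0 <= b) ->
  (exists a b, S (a, b) /\ a < 0) -> (exists a b, S (a, b) /\ 0 < a) ->
  exists k, forall a b, S (a, b) -> k * a <= b.
Proof.
move=> Scvx S0 [a0 [b0 [S0m a0lt0]]] [a1 [b1 [S1p a1gt0]]].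
pose L := [set k | exists a b, [/\ S (a, b), a < 0 & k = b / a]].
have key a b a' b' : S (a, b) -> a < 0 -> S (a', b') -> 0 < a' ->
    b / a <= b' / a'.
  move=> Sab alt0 Sab' a'gt0.
  have D0 : 0 < a' - a by lra.
  (* With this coefficient the convex combination falls on the vertical axis, where [S0] applies. *)
  have t01 : 0 <= a' / (a' - a) <= 1.
    by rewrite divr_ge0 ?ler_pdivrMr//=; lra.
  have := Scvx _ _ _ _ _ Sab Sab' t01.
  rewrite (_ : _ * a + _ = 0); last by field; lra.
  move=> /S0.
  rewrite (_ : _ * b + _ = (a' * b - a * b') / (a' - a)); last by field; lra.
  rewrite pmulr_lge0 ?invr_gt0// => h.
  rewrite ler_pdivlMr// mulrAC ler_ndivrMr//; lra.
have Lub : has_sup L.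
  split; first by exists (b0 / a0), a0, b0.
  by exists (b1 / a1) => _ [a [b [? ? ->]]]; exact: key.
exists (sup L) => a b Sab; case: (ltgtP a 0) => [alt0|agt0|a0E].
- have : b / a <= sup L by apply: ub_le_sup; [exact: Lub.2|exists a, b].
  by rewrite ler_ndivrMr.
- have : sup L <= b / a.
    by apply: ge_sup; [exact: Lub.1|move=> _ [? [? [? ? ->]]]; exact: key].
  by rewrite ler_pdivlMr.
- by rewrite a0E mulr0; apply: S0; rewrite -a0E.
Qed.

End Separation.

(** * Optimal values over a set *)

Section MinValue.
Context {R : realType} {U : Type}.
Implicit Types (A : set U) (F : U -> \bar R) (m : \bar R).

Lemma min_value_le A F x : A x -> (min_value A F <= F x)%E.
Proof. by move=> Ax; apply: ereal_inf_lbound; exists x. Qed.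

Lemma le_min_value A F m :
  (forall x, A x -> (m <= F x)%E) -> (m <= min_value A F)%E.
Proof. by move=> h; apply: le_ereal_inf_tmp => _ [x Ax <-]; exact: h. Qed.

Lemma le_max_value A F x : A x -> (F x <= max_value A F)%E.
Proof. by move=> Ax; apply: ereal_sup_ubound; exists x. Qed.

Lemma le_max_value_trans A F x m :
  A x -> (m <= F x)%E -> (m <= max_value A F)%E.
Proof. by move=> Ax mF; apply: le_trans mF _; exact: le_max_value. Qed.

Lemma max_value_le A F m :
  (forall x, A x -> (F x <= m)%E) -> (max_value A F <= m)%E.
Proof. by move=> h; apply: ge_ereal_sup => _ [x Ax <-]; exact: h. Qed.

Lemma argmin_min_value A F x : argmin A F x -> F x = min_value A F.
Proof.
move=> [Ax Fx]; apply/eqP; rewrite eq_le min_value_le// andbT.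
exact: le_min_value.
Qed.

Lemma min_value_lt A F m :
  (min_value A F < m)%E -> exists2 x, A x & (F x < m)%E.
Proof. by move=> /ereal_inf_lt [_ [x Ax <-] ?]; exists x. Qed.

Lemma max_value_gt A F m :
  (m < max_value A F)%E -> exists2 x, A x & (m < F x)%E.
Proof. by move=> /ereal_sup_gt [_ [x Ax <-] ?]; exists x. Qed.

End MinValue.

(** * Pointwise lower semicontinuity and minimizers on compact sets *)

Section Semicontinuity.
Context {R : realType}.
Local Open Scope ereal_scope.

(** The notion is pointwise because a generator is lower semicontinuous at every positive point, but
    not necessarily at 0. *)
Definition lsc_at (X : topologicalType) (f : X -> \bar R) (x : X) :=
  forall a : R, a%:E < f x -> \forall y \near x, a%:E < f y.

Lemma lower_semicontinuous_at (X : topologicalType) (f : X -> \bar R) x :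
  lower_semicontinuous f -> lsc_at f x.
Proof. by move=> fl a /fl[V xV Vf]; apply: filterS xV. Qed.

Lemma lsc_at_comp (X Y : topologicalType) (g : X -> Y) (f : Y -> \bar R) x :
  {for x, continuous g} -> lsc_at f (g x) -> lsc_at (f \o g) x.
Proof. by move=> gc fl a /fl /gc. Qed.

Lemma continuous_lsc_at (X : topologicalType) (f : X -> R) x :
  {for x, continuous f} -> lsc_at (EFin \o f) x.
Proof.
move=> fc a /=; rewrite lte_fin => afx.
have h : \forall y \near x, (a < f y)%R by exact: fc _ (lt_nbhsr afx).
by apply: filterS h => y /=; rewrite lte_fin.
Qed.

Lemma lsc_at_max_value (X : topologicalType) (U : Type) (A : set U)
    (f : X -> U -> \bar R) x :
  (forall u, A u -> lsc_at (f ^~ u) x) ->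
  lsc_at (fun y => max_value A (f y)) x.
Proof.
move=> fl a /max_value_gt[u Au au].
apply: filterS (fl u Au a au) => y h; apply: lt_le_trans h _.
exact: le_max_value.
Qed.

Lemma lsc_atD (X : topologicalType) (f g : X -> \bar R) x :
  (forall y, f y != -oo) -> (forall y, g y != -oo) ->
  lsc_at f x -> lsc_at g x -> lsc_at (f \+ g) x.
Proof.
move=> f0 g0 fl gl a /= afg.
suff [b [c [bf cg abc]]] : exists b c : R,
    [/\ b%:E < f x, c%:E < g x & (a <= b + c)%R].
  apply: filter_app (gl c cg); apply: filter_app (fl b bf).
  apply: nearW => y bfy cgy; rewrite (@le_lt_trans _ _ (b%:E + c%:E))//.
  by apply: lteD.
move: afg (f0 x) (g0 x); case: (f x) => [u| |]; case: (g x) => [v| |] // afg _ _.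
- move: afg; rewrite -EFinD lte_fin => afg.
  (* The surplus [u + v - a] is shared equally between the two thresholds. *)
  exists (u - (u + v - a) / 2)%R, (v - (u + v - a) / 2)%R.
  by rewrite !lte_fin; split; lra.
- by exists (u - 1)%R, (a - u + 1)%R; clear afg; rewrite lte_fin ltry; split => //; lra.
- by exists (a - v + 1)%R, (v - 1)%R; clear afg; rewrite lte_fin ltry; split => //; lra.
- by exists a, 0%R; clear afg; rewrite !ltry; split => //; lra.
Qed.

Lemma lsc_at_sum (X : topologicalType) (I : Type) (r : seq I)
    (f : I -> X -> \bar R) x :
  (forall i y, f i y != -oo) -> (forall i, lsc_at (f i) x) ->
  lsc_at (fun y => \sum_(i <- r) f i y) x.
Proof.
move=> f0 fl; elim: r => [|i r IH].
  by move=> a; rewrite big_nil => a0; apply: nearW => y; rewrite big_nil.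
rewrite (_ : (fun y => _) = (f i \+ (fun y => \sum_(j <- r) f j y))).
  apply: lsc_atD => // y.
  elim: r {IH} => [|j r IH]; first by rewrite big_nil.
  by rewrite big_cons adde_eq_ninfty negb_or f0.
by apply/funext => y; rewrite big_cons.
Qed.

Lemma lsc_atZ (X : topologicalType) (k : R) (f : X -> \bar R) x :
  (0 <= k)%R -> lsc_at f x -> lsc_at (fun y => k%:E * f y) x.
Proof.
rewrite le_eqVlt => /predU1P[<- _ a|k0 fl a].
  by rewrite mul0e => a0; apply: nearW => y; rewrite mul0e.
have kP (y : \bar R) : (a%:E < k%:E * y) = ((a / k)%R%:E < y).
  by rewrite EFinM lte_pdivrMr// muleC.
by rewrite kP => /fl; apply: filterS => y; rewrite kP.
Qed.

Lemma lte_fin_between (x y : \bar R) :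
  x < y -> exists2 a : R, x < a%:E & a%:E < y.
Proof.
case: x y => [u| |] [v| |]// h.
- by exists ((u + v) / 2)%R; move: h; rewrite !lte_fin => h; lra.
- by exists (u + 1)%R; rewrite ?lte_fin ?ltry//; clear h; lra.
- by exists (v - 1)%R; rewrite ?lte_fin ?ltNyr//; clear h; lra.
- by exists 0%R; rewrite ?ltNyr ?ltry.
Qed.

(** If the infimum [m] is not attained, the sets where [f] exceeds a real level above [m] cover [K];
    by compactness one level works on all of [K], so it is at most [m], a contradiction. *)
Lemma compact_argmin (X : topologicalType) (K : set X) (f : X -> \bar R) :
  compact K -> K !=set0 -> (forall x, K x -> lsc_at f x) -> argmin K f !=set0.
Proof.
move=> cK [x0 Kx0] fl; set m := min_value K f.
have [[x Kx fx]|nm] := pselect (exists2 x, K x & f x <= m).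
  by exists x; split => // y Ky; rewrite (le_trans fx)// min_value_le.
have {}nm x : K x -> m < f x.
  by move=> Kx; rewrite ltNge; apply/negP => ?; apply: nm; exists x.
pose D := [set a : R | m < a%:E].
have [a0 a0D _] := lte_fin_between (nm _ Kx0).
(* The filter of real levels decreasing to [m], along which compactness is applied as a
   near-covering property. *)
pose F := filter_from D (fun a => [set b : R | m < b%:E /\ (b <= a)%R]).
have FF : Filter F.
  apply: filter_from_filter; first by exists a0.
  move=> a b aD bD; exists (Num.min a b).
    by rewrite /D /=; case: (leP a b).
  by move=> c [mc]; rewrite le_min => /andP[? ?].
have [|a aD /(_ a) Ka] :=
    (compact_near_coveringP K).1 cK _ F (fun a x => a%:E < f x) FF.
  move=> x Kx; have [a ma afx] := lte_fin_between (nm x Kx).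
  exists ([set y | a%:E < f y], [set b : R | m < b%:E /\ (b <= a)%R]).
    by split; [exact: fl Kx _ afx|exists a].
  by move=> [y b] /= [ay [_ ba]]; rewrite (le_lt_trans _ ay)// lee_fin.
have : a%:E <= m by apply: le_min_value => x /(Ka (conj aD (lexx _))) /ltW.
by rewrite leNgt aD.
Qed.

End Semicontinuity.

(** The limit [t -> 0], made explicit: for [d < 0] the choice [t = - d / (|c| + 1 - d)] lies in []0,
    1[] and would give [c + |c| + 1 - d <= 0]. *)
Lemma ge0_of_small_multiples (R : realFieldType) (c d : R) :
  (forall t, 0 < t < 1 -> t * c <= d) -> 0 <= d.
Proof.
move=> h; rewrite leNgt; apply/negP => d0.
have c0 : 0 <= `|c| by [].
have D0 : 0 < `|c| + 1 - d by lra.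
have := h (- d / (`|c| + 1 - d)); rewrite divr_gt0 ?ltr_pdivrMr//; last lra.
rewrite mul1r mulrAC ler_pdivrMr//; have := ler_norm (- c); rewrite normrN.
by move=> cc /(_ ltac:(lra)); nra.
Qed.

(** * Divergence generators and their conjugates *)

Section Divergence.
Context {R : realType} (phi : R -> \bar R).
Hypothesis hphi : divergence_generator phi.

Let phir s := fine (phi s).

Lemma generator_fin s : 0 < s -> phi s = (phir s)%:E.
Proof. by move=> s0; rewrite fineK//; case: hphi => _ _ + _; apply. Qed.

Lemma generator_fine1 : phir 1 = 0.
Proof. by rewrite /phir; case: hphi => _ -> _ _. Qed.

(** Only 0 is in doubt: a value [-oo] there would, by convexity between 0 and 1, spread to [1/2],
    where [phi] is finite. *)
Lemma generator_gtNy s : phi s != -oo%E.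
Proof.
case: (ltgtP s 0) => [s0|s0|->].
- by case: hphi => _ _ _ ->.
- by rewrite generator_fin.
- apply/eqP => h0; case: hphi => cvx phi1 _ _.
  have t01 : 0 <= (2^-1 : R) <= 1 by lra.
  have := cvx 0 1 2^-1 t01; rewrite phi1 h0 mule0 adde0.
  rewrite gt0_muleNy ?lte_fin// mulr0 add0r mulr1 generator_fin; last lra.
  by [].
Qed.

Lemma generator_fine_convex s s' t : 0 < s -> 0 < s' -> 0 <= t <= 1 ->
  phir (t * s + (1 - t) * s') <= t * phir s + (1 - t) * phir s'.
Proof.
move=> s0 s'0 t01; case: hphi => cvx _ _ _.
have ts0 : 0 < t * s + (1 - t) * s' by nra.
by have := cvx s s' t t01; rewrite !generator_fin.
Qed.

(** The slope supports, at the origin, the epigraph of [phir] translated by [(x, phir x)]. *)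
Lemma generator_subgradient x :
  0 < x -> exists k, forall y, 0 < y -> phir x + k * (y - x) <= phir y.
Proof.
move=> x0.
pose S := [set ab : R * R | exists y, [/\ 0 < y, ab.1 = y - x
  & phir y - phir x <= ab.2]].
have [||||k hk] := @convex_support_slope R S.
- move=> a b a' b' t [y [/= y0 -> yb]] [y' [/= y'0 -> yb']] t01.
  exists (t * y + (1 - t) * y'); split => /=; [nra|ring|].
  have := generator_fine_convex y0 y'0 t01; nra.
- move=> b [y [y0 /= y_x]]; rewrite (_ : y = x); last lra.
  by rewrite subrr.
- exists (x / 2 - x), (phir (x / 2) - phir x); split; last lra.
  by exists (x / 2); split => //; lra.
- exists (x * 2 - x), (phir (x * 2) - phir x); split; last lra.
  by exists (x * 2); split => //; lra.
exists k => y y0; have := hk (y - x) (phir y - phir x).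
by move=> /(_ (ex_intro _ y (And3 y0 erefl (lexx _)))); lra.
Qed.

(* The supremum defining the conjugate may be restricted to [s > 0], since a
   convex function is at least its right limit at [0]. *)
Lemma scaled_conjugate_le lam w B : 0 <= lam ->
  (forall s, 0 < s -> s * w - lam * phir s <= B) ->
  (scaled_conjugate phi lam w%:E <= B%:E)%E.
Proof.
move=> lam0 h.
have h0 : (- (lam%:E * phi 0) <= B%:E)%E.
  have := generator_gtNy 0; case E : (phi 0) => [u| |]// _; last first.
    (* Here [phi 0 = +oo]. For [lam = 0] the product is 0 by convention, and [0 <= B] follows from
       [h] as [s -> 0]. *)
    move: lam0; rewrite le_eqVlt => /predU1P[l0|l0].
      rewrite -l0 mul0e oppe0 lee_fin.
      apply: (@ge0_of_small_multiples _ w) => t /andP[t0 _].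
      by have := h t t0; rewrite -l0 mul0r subr0.
    by rewrite gt0_muley ?lte_fin// leNye.
  rewrite -EFinM -EFinN lee_fin -subr_ge0.
  apply: (@ge0_of_small_multiples _ (w + lam * u)) => t /andP[t0 t1].
  (* Convexity between 1, where [phi] vanishes, and 0; letting [t -> 0] then carries the bound [h]
     to [s = 0]. *)
  have : phir t <= (1 - t) * u.
    case: hphi => cvx phi1 _ _.
    have t01 : 0 <= t <= 1 by lra.
    have := cvx 1 0 t t01; rewrite phi1 E mule0 add0e mulr0 mulr1 addr0.
    by rewrite generator_fin// lee_fin.
  move=> /(ler_wpM2l lam0); have := h t t0; nra.
rewrite /scaled_conjugate; case: ifPn => [l0|]; last first.
  rewrite -leNgt => l0; have {l0}l0 : lam = 0 by apply/le_anti/andP.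
  apply: max_value_le => s /=; rewrite le_eqVlt => /predU1P[<-|s0].
    by rewrite mul0e add0e.
  by rewrite generator_fin// -!EFinM -EFinB lee_fin; exact: h.
rewrite -lee_pdivlMl//; apply: max_value_le => s /=.
rewrite lee_pdivlMl// le_eqVlt => /predU1P[<-|s0].
  rewrite mul0e add0e; apply: le_trans h0.
  by rewrite muleN.
rewrite generator_fin// [leLHS](_ : _ = (s * w - lam * phir s)%:E).
  by rewrite lee_fin h.
by congr EFin => /=; field; rewrite gt_eqF.
Qed.

End Divergence.

Section Conjugate.
Context {R : realType} (phi : R -> \bar R).
Hypothesis hphi : divergence_generator phi.
Let phir s := fine (phi s).

Lemma le_scaled_conjugate lam w s : 0 <= lam -> 0 <= s ->
  phi s \is a fin_num ->
  ((s * w - lam * phir s)%:E <= scaled_conjugate phi lam w%:E)%E.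
Proof.
move=> lam0 s0 fs; rewrite /scaled_conjugate; case: ifPn => [l0|].
  rewrite -lee_pdivrMl//; apply: (@le_max_value_trans _ _ _ _ s) => //=.
  rewrite -(fineK fs) -/(phir s).
  rewrite [leRHS](_ : _ = (lam^-1 * (s * w - lam * phir s))%:E)//.
  by congr EFin => /=; field; rewrite gt_eqF.
rewrite -leNgt => l0; have {l0}-> : lam = 0 by apply/le_anti/andP.
apply: (@le_max_value_trans _ _ _ _ s) => //=.
by rewrite mul0e mul0r subr0 sube0.
Qed.

(** Witnessed by [s = 1], where [phi] vanishes. *)
Lemma scaled_conjugate_pinfty lam : 0 <= lam ->
  scaled_conjugate phi lam +oo%E = +oo%E.
Proof.
have phi1 : phi 1 = 0%E by case: hphi.
move=> lam0; apply/eqP; rewrite eq_le leey /scaled_conjugate /=.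
case: ifPn => [l0|_].
  rewrite gt0_mulye ?lte_fin ?invr_gt0// -lee_pdivrMl//.
  apply: (@le_max_value_trans _ _ _ _ 1) => //=.
  by rewrite mul1e phi1 sube0 leey.
apply: (@le_max_value_trans _ _ _ _ 1) => //=.
by rewrite mul1e phi1 mule0 sube0.
Qed.

End Conjugate.

(** * The ambiguity set around the uniform weights *)

Section AmbiguitySet.
Context {R : realType} (T : nat) (phi : R -> \bar R) (delta : R).
Hypothesis hT : (0 < T)%N.
Hypothesis hphi : divergence_generator phi.
Implicit Types p : 'cV[R]_T.

Definition weighted_sum p (d : 'I_T -> \bar R) : \bar R :=
  (\sum_j (p j 0)%:E * d j)%E.

(** An infinite term counts as 0 here, so this agrees with [divergence] only under the finiteness
    hypotheses that accompany it below. *)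
Definition fine_divergence p : R :=
  T%:R^-1 * \sum_j fine (phi (T%:R * p j 0)).

Let T0 : 0 < T%:R :> R. Proof. by rewrite ltr0n. Qed.

Lemma divergence_terms p : divergence phi p (uniform T) =
  (\sum_(j < T) (T%:R^-1)%:E * phi (T%:R * p j 0)%R)%E.
Proof.
by apply: eq_bigr => j _; rewrite /uniform !mxE invrK mulrC.
Qed.

Lemma fine_divergenceE p : (forall j, phi (T%:R * p j 0) \is a fin_num) ->
  divergence phi p (uniform T) = (fine_divergence p)%:E.
Proof.
move=> h; rewrite divergence_terms /fine_divergence mulr_sumr -sumEFin.
by apply: eq_bigr => j _; rewrite EFinM fineK.
Qed.

Lemma fin_num_of_divergence_le p j :
  (divergence phi p (uniform T) <= delta%:E)%E -> phi (T%:R * p j 0) \is a fin_num.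
Proof.
move=> h; rewrite fin_numE generator_gtNy//=; apply/negP => /eqP jy.
move: h; rewrite divergence_terms (_ : (\sum_(_ < T) _)%E = +oo%E)//.
apply/esum_eqyP => [i _|].
  have := generator_gtNy hphi (T%:R * p i 0).
  by case: (phi _) => [u| |]// _; rewrite gt0_muley// lte_fin invr_gt0.
exists j; split; rewrite ?mem_index_enum// jy gt0_muley// lte_fin.
by rewrite invr_gt0.
Qed.

Lemma ambiguity_setP p : ambiguity_set phi delta p <->
  [/\ simplex p, forall j, phi (T%:R * p j 0) \is a fin_num
    & fine_divergence p <= delta].
Proof.
split=> [[sp dp]|[sp fp dp]].
  have fp j : phi (T%:R * p j 0) \is a fin_num by exact: fin_num_of_divergence_le.
  by split => //; rewrite -lee_fin -fine_divergenceE.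
by split => //; rewrite fine_divergenceE ?lee_fin.
Qed.

Lemma pos_fin_num p : (forall j, 0 < p j 0) ->
  forall j, phi (T%:R * p j 0) \is a fin_num.
Proof. by move=> p0 j; case: hphi => _ _ + _; apply; rewrite mulr_gt0. Qed.

Lemma simplex_uniform : simplex (uniform T : 'cV[R]_T).
Proof.
split => [i|]; first by rewrite mxE invr_ge0 ltW.
under eq_bigr do rewrite mxE.
by rewrite sumr_const card_ord -[LHS]mulr_natr mulVf// gt_eqF.
Qed.

Lemma uniform_gt0 j : 0 < (uniform T : 'cV[R]_T) j 0.
Proof. by rewrite mxE invr_gt0. Qed.

Lemma fine_divergence_uniform : fine_divergence (uniform T) = 0.
Proof.
rewrite /fine_divergence big1 ?mulr0// => j _; rewrite mxE divff ?gt_eqF//.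
exact: generator_fine1.
Qed.

Lemma ambiguity_set_uniform : 0 <= delta -> ambiguity_set phi delta (uniform T).
Proof.
move=> d0; apply/ambiguity_setP; split; first exact: simplex_uniform.
- exact: pos_fin_num uniform_gt0.
- by rewrite fine_divergence_uniform.
Qed.

Lemma simplex_convex p p' t : 0 <= t <= 1 ->
  simplex p -> simplex p' -> simplex (t *: p + (1 - t) *: p').
Proof.
move=> t01 [p0 p1] [p'0 p'1]; split => [i|].
  by rewrite !mxE; have := p0 i; have := p'0 i; nra.
under eq_bigr do rewrite !mxE.
by rewrite big_split/= -!mulr_sumr p1 p'1; ring.
Qed.

Lemma mix_fin_num p p' t : 0 <= t <= 1 ->
  (forall j, phi (T%:R * p j 0) \is a fin_num) ->
  (forall j, phi (T%:R * p' j 0) \is a fin_num) -> forall j,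
  phi (T%:R * (t *: p + (1 - t) *: p') j 0) \is a fin_num /\
  fine (phi (T%:R * (t *: p + (1 - t) *: p') j 0)) <=
    t * fine (phi (T%:R * p j 0)) + (1 - t) * fine (phi (T%:R * p' j 0)).
Proof.
move=> t01 fp fp' j; case: (hphi) => cvx _ _ _.
have := cvx (T%:R * p j 0) (T%:R * p' j 0) t t01.
rewrite (_ : t * (T%:R * _) + _ * (T%:R * _) =
    T%:R * (t *: p + (1 - t) *: p') j 0); last first.
  by rewrite !mxE; ring.
rewrite -(fineK (fp j)) -(fineK (fp' j)).
have := generator_gtNy hphi (T%:R * (t *: p + (1 - t) *: p') j 0).
by case: (phi (T%:R * (t *: p + _) j 0)).
Qed.

Lemma fine_divergence_convex p p' t : 0 <= t <= 1 ->
  (forall j, phi (T%:R * p j 0) \is a fin_num) ->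
  (forall j, phi (T%:R * p' j 0) \is a fin_num) ->
  fine_divergence (t *: p + (1 - t) *: p') <=
    t * fine_divergence p + (1 - t) * fine_divergence p'.
Proof.
move=> t01 fp fp'; rewrite /fine_divergence !(mulrCA _ T%:R^-1) -mulrDr.
rewrite ler_wpM2l ?invr_ge0 ?ler0n// !mulr_sumr -big_split/=.
by apply: ler_sum => j _; have [] := mix_fin_num t01 fp fp' j.
Qed.

Lemma ambiguity_set_convex p p' t : 0 <= t <= 1 ->
  ambiguity_set phi delta p -> ambiguity_set phi delta p' ->
  ambiguity_set phi delta (t *: p + (1 - t) *: p').
Proof.
move=> t01 /ambiguity_setP[sp fp dp] /ambiguity_setP[sp' fp' dp'].
apply/ambiguity_setP; split; first exact: simplex_convex.
  by move=> j; have [] := mix_fin_num t01 fp fp' j.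
by apply: le_trans (fine_divergence_convex t01 fp fp') _; nra.
Qed.

(** Jensen's inequality: each term lies above the supporting line of [phi] at 1, and these linear
    terms add up to 0 because the weights sum to 1. *)
Lemma fine_divergence_ge0 p : simplex p -> (forall j, 0 < p j 0) ->
  0 <= fine_divergence p.
Proof.
move=> [_ p1] p0; have [k hk] := generator_subgradient hphi ltr01.
apply: mulr_ge0; first by rewrite invr_ge0 ltW.
apply: (@le_trans _ _ (\sum_j k * (T%:R * p j 0 - 1))); last first.
  apply: ler_sum => j _; have := hk (T%:R * p j 0).
  by rewrite generator_fine1// add0r; apply; rewrite mulr_gt0.
rewrite -mulr_sumr sumrB -mulr_sumr p1 sumr_const card_ord.
by rewrite mulr1 subrr mulr0.
Qed.

End AmbiguitySet.

Arguments weighted_sum {R T} p d.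

(** Coordinates can be maximized independently, so the [b j] are the coordinatewise suprema. Each is
    finite, as is seen by freezing the other coordinates at 1. *)
Lemma separable_sup (R : realType) (T : nat) (h : 'I_T -> R -> R) (B : R) :
  (0 < T)%N ->
  (forall s : 'I_T -> R, (forall j, 0 < s j) -> \sum_j h j (s j) <= B) ->
  exists2 b : 'I_T -> R, \sum_j b j <= B & forall j s, 0 < s -> h j s <= b j.
Proof.
move=> hT hB; pose A j := [set h j s | s in [set s | 0 < s]].
have A_sup j : has_sup (A j).
  split; first by exists (h j 1), 1 => //=.
  exists (B - \sum_(i | i != j) h i 1) => _ [s /= s0 <-].
  have := hB (fun i => if i == j then s else 1); rewrite (bigD1 j)//= eqxx.
  rewrite (eq_bigr (fun i => h i 1)); last by move=> i /negPf ->.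
  rewrite lerBrDr; apply => i; by case: ifP.
exists (fun j => sup (A j)) => [|j s s0]; last first.
  by apply: ub_le_sup; [exact: (A_sup j).2|exists s].
apply/ler_addgt0Pr => e e0.
have T0 : 0 < T%:R :> R by rewrite ltr0n.
(* The tolerance [e] is divided among the [T] coordinates. *)
have : forall j, exists s, 0 < s /\ sup (A j) - e / T%:R < h j s.
  move=> j; have [_ [s s0 <-] ?] := sup_adherent (divr_gt0 e0 T0) (A_sup j).
  by exists s.
move=> /choice[s hs].
have := hB s (fun j => (hs j).1).
have : \sum_j (sup (A j) - e / T%:R) <= \sum_j h j (s j).
  by apply: ler_sum => j _; apply: ltW; exact: (hs j).2.
have -> : \sum_j (sup (A j) - e / T%:R) = \sum_j sup (A j) - e.
  rewrite sumrB sumr_const card_ord; congr (_ - _).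
  by rewrite -[LHS]mulr_natr divfK// gt_eqF.
lra.
Qed.

(** * Weak duality and the multiplier of the normalization *)

Section Duality.
Context {R : realType} (T : nat) (phi : R -> \bar R) (delta : R).
Hypothesis hT : (0 < T)%N.
Hypothesis hphi : divergence_generator phi.
Let phir s := fine (phi s).
Implicit Types (p : 'cV[R]_T) (r : 'I_T -> R) (d : 'I_T -> \bar R).

Definition dual_bound d (lam xi : R) : \bar R :=
  (xi%:E + (delta * lam)%:E + (T%:R^-1)%:E *
     \sum_(j < T) scaled_conjugate phi lam (d j - xi%:E))%E.

Let T0 : 0 < T%:R :> R. Proof. by rewrite ltr0n. Qed.

Lemma weighted_sum_EFin p r :
  weighted_sum p (EFin \o r) = (\sum_j p j 0 * r j)%:E.
Proof. by rewrite -sumEFin. Qed.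

(** The infinite term cannot be cancelled: evaluating the other conjugates at [s = 1] keeps them
    above [-oo]. *)
Lemma dual_bound_pinfty d lam xi j : 0 <= lam -> (forall j, 0 <= d j)%E ->
  d j = +oo%E -> dual_bound d lam xi = +oo%E.
Proof.
move=> lam0 d0 dj; rewrite /dual_bound (_ : (\sum_(_ < T) _)%E = +oo%E).
  by rewrite gt0_muley ?lte_fin ?invr_gt0.
apply/esum_eqyP => [i _|].
  have := d0 i; case: (d i) => [u| |]// _; last first.
    by rewrite addye// scaled_conjugate_pinfty.
  rewrite -ltNye; apply: lt_le_trans (le_scaled_conjugate _ lam0 ler01 _).
    exact: ltNyr.
  by case: hphi => _ ->.
exists j; split; rewrite ?mem_index_enum// dj addye//.
exact: scaled_conjugate_pinfty.
Qed.

(** Fenchel-Young in each coordinate at [s = T * p_j]: on summation [xi] cancels since the weights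
    sum to 1, and what is left over is [lam] times the nonnegative slack of the divergence
    constraint. *)
Lemma weak_duality p d lam xi : ambiguity_set phi delta p -> 0 <= lam ->
  (forall j, 0 <= d j)%E -> (weighted_sum p d <= dual_bound d lam xi)%E.
Proof.
move=> /(ambiguity_setP _ hT hphi)[[p0 p1] fp dp] lam0 d0.
have [[j dj]|dfin] := pselect (exists j, d j = +oo%E).
  by rewrite (dual_bound_pinfty _ lam0 d0 dj) leey.
have -> : d = EFin \o (fine \o d).
  apply/funext => j /=; rewrite fineK// ge0_fin_numE// ltey.
  by apply/eqP => dj; apply: dfin; exists j.
move: (fine \o d) => r; rewrite weighted_sum_EFin /dual_bound.
apply: (@le_trans _ _ (xi%:E + (delta * lam)%:E + T%:R^-1%:E *
   \sum_(j < T) ((T%:R * p j 0) * (r j - xi) - lam * phir (T%:R * p j 0))%:E)%E).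
  rewrite sumEFin.
  have -> : \sum_j (T%:R * p j 0 * (r j - xi) - lam * phir (T%:R * p j 0)) =
      T%:R * (\sum_j p j 0 * r j - xi) - lam * \sum_j phir (T%:R * p j 0).
    have e : xi = \sum_j p j 0 * xi by rewrite -mulr_suml p1 mul1r.
    rewrite [in RHS]e -sumrB !mulr_sumr -sumrB.
    by apply: eq_bigr => j _; ring.
  rewrite -EFinM -!EFinD lee_fin mulrBr mulKf ?gt_eqF// mulrCA.
  rewrite -/(fine_divergence phi p); nra.
rewrite leeD2l// lee_wpmul2l ?lee_fin ?invr_ge0 ?ler0n//.
apply: lee_sum => j _; apply: le_scaled_conjugate => //.
by rewrite mulr_ge0// ler0n.
Qed.

Lemma sum_mix p p' t r :
  \sum_j (t *: p + (1 - t) *: p') j 0 * r j =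
  t * (\sum_j p j 0 * r j) + (1 - t) * (\sum_j p' j 0 * r j).
Proof.
rewrite !mulr_sumr -big_split/=; apply: eq_bigr => j _; rewrite !mxE; ring.
Qed.

Lemma sum_mix1 p p' t :
  \sum_j (t *: p + (1 - t) *: p') j 0 =
  t * (\sum_j p j 0) + (1 - t) * (\sum_j p' j 0).
Proof.
rewrite !mulr_sumr -big_split/=; apply: eq_bigr => j _; rewrite !mxE; ring.
Qed.

(* The multiplier [xi] of the constraint [\sum_j p_j = 1]. *)
Lemma dual_bound_of_lagrangian r lam s : 0 <= lam ->
  (forall p, simplex p -> (forall j, 0 < p j 0) ->
     \sum_j p j 0 * r j - lam * (fine_divergence phi p - delta) <= s) ->
  exists xi, (dual_bound (EFin \o r) lam xi <= s%:E)%E.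
Proof.
move=> lam0 hs.
pose L p := s - \sum_j p j 0 * r j + lam * (fine_divergence phi p - delta).
(* The abscissa is the excess of the total weight over 1, so the vertical axis corresponds to the
   simplex, where [hs] makes [L] nonnegative. *)
pose S := [set ab : R * R | exists p, [/\ forall j, 0 < p j 0,
  ab.1 = \sum_j p j 0 - 1 & L p <= ab.2]].
(* Totals [1/2] and [2] provide points of [S] on both sides of the axis. *)
have sumc (c : R) : \sum_(j < T) (const_mx (c / T%:R) : 'cV[R]_T) j 0 = c.
  under eq_bigr do rewrite mxE.
  by rewrite sumr_const card_ord -[LHS]mulr_natr divfK// gt_eqF.
have [||||k hk] := @convex_support_slope R S.
- move=> a b a' b' t [p [/= p0 -> pb]] [p' [/= p'0 -> pb']] t01.
  exists (t *: p + (1 - t) *: p'); split => /=.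
  + by move=> j; rewrite !mxE; have := p0 j; have := p'0 j; nra.
  + by rewrite sum_mix1; ring.
  + have := fine_divergence_convex hphi t01
      (pos_fin_num hT hphi p0) (pos_fin_num hT hphi p'0).
    move: pb pb'; rewrite /L sum_mix => pb pb' /(ler_wpM2l lam0).
    case/andP: t01 => t0 t1.
    have := ler_wpM2l t0 pb.
    have t1' : 0 <= 1 - t by lra.
    have := ler_wpM2l t1' pb'; lra.
- move=> b [p [p0 /= p1 Lb]]; apply: le_trans Lb.
  have := hs p; rewrite /L => /(_ _ p0) h; have : simplex p.
    by split => [i|]; [exact: ltW|lra].
  by move=> /h; lra.
- exists (2^-1 - 1), (L (const_mx (2^-1 / T%:R))); split; last lra.
  exists (const_mx (2^-1 / T%:R)); split => //=; last by rewrite sumc.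
  by move=> j; rewrite mxE divr_gt0.
- exists (2 - 1), (L (const_mx (2 / T%:R))); split; last lra.
  exists (const_mx (2 / T%:R)); split => //=; last by rewrite sumc.
  by move=> j; rewrite mxE divr_gt0.
exists (- k).
have [s' s'0|b hb bh] :=
    @separable_sup _ _ (fun j x => x * (r j - - k) - lam * phir x)
      (T%:R * (s - lam * delta + k)) hT.
  (* With [s' = T * p] free in the positive orthant, the Lagrangian is a sum of functions of one
     coordinate each. *)
  pose p : 'cV[R]_T := \col_j (s' j / T%:R).
  have p0 j : 0 < p j 0 by rewrite mxE divr_gt0.
  have := hk (\sum_j p j 0 - 1) (L p).
  move=> /(_ (ex_intro _ p (And3 p0 erefl (lexx _)))).
  rewrite /L /fine_divergence.
  have Tp j : T%:R * p j 0 = s' j by rewrite mxE mulrC divfK// gt_eqF.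
  under [X in T%:R^-1 * X]eq_bigr do rewrite Tp.
  move=> h; rewrite -ler_pdivrMl//.
  rewrite sumrB -mulr_sumr mulrBr.
  rewrite (eq_bigr (fun j => T%:R * (p j 0 * r j + k * p j 0))); last first.
    by move=> j _; rewrite -Tp; ring.
  rewrite -mulr_sumr mulKf ?gt_eqF// big_split/= -mulr_sumr.
  move: h; rewrite /phir; nra.
rewrite /dual_bound.
apply: (@le_trans _ _ ((- k)%:E + (delta * lam)%:E + T%:R^-1%:E *
   \sum_(j < T) (b j)%:E)%E).
  rewrite leeD2l// lee_wpmul2l ?lee_fin ?invr_ge0 ?ler0n//.
  apply: lee_sum => j _; rewrite -EFinB.
  by apply: scaled_conjugate_le => // x; exact: bh.
rewrite sumEFin -EFinM -!EFinD lee_fin.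
move: hb; rewrite -ler_pdivrMl//; lra.
Qed.

End Duality.

(** * Compactness of the simplex *)

Section SimplexTopology.
Context {R : realType}.

Lemma continuous_sum (X : topologicalType) (I : Type) (r : seq I)
    (f : I -> X -> R) :
  (forall i, continuous (f i)) -> continuous (fun x => \sum_(i <- r) f i x).
Proof.
by move=> fc; apply: continuous_big => //; exact: (@add_continuous R^o).
Qed.

Lemma affine_continuous (a b : R) : continuous (fun y => a * y + b).
Proof.
move=> y; apply: (@continuousD _ R^o _ ( *%R a) (cst b)).
  exact: mulrl_continuous.
exact: cst_continuous.
Qed.

Lemma trmx_continuous m n : continuous (@trmx R m n).
Proof.
move=> v A [P vP PA]; exists (fun i j => P j i).
  by move=> i j; have := vP j i; rewrite mxE.
by move=> N NP; apply: PA => i j; rewrite mxE; exact: NP.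
Qed.

Lemma closed_le_continuous (X : topologicalType) (f : X -> R) (a : R) :
  continuous f -> closed [set x | f x <= a].
Proof.
by move=> fc; apply: (@preimage_closed _ _ f [set y | y <= a]) => //; exact: closed_le.
Qed.

(** A closed subset of the unit cube, which is compact as a product of segments on row vectors and
    is carried to columns by transposition. *)
Lemma compact_simplex n : compact (@simplex R n).
Proof.
have cA : compact [set v : 'rV[R]_n | forall i, `[0, 1]%classic (v ord0 i)].
  exact: (rV_compact (fun=> @segment_compact _ 0 1)).
have cB := continuous_compact (continuous_subspaceT (@trmx_continuous 1 n)) cA.
apply: subclosed_compact cB _ => [|u [u0 u1]].
- rewrite (_ : @simplex R n =
    (\bigcap_i [set u : 'cV[R]_n | - u i 0 <= 0]) `&`
    ([set u : 'cV[R]_n | \sum_i u i 0 <= 1] `&`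
     [set u : 'cV[R]_n | - (\sum_i u i 0) <= - 1])).
    apply: closedI.
      apply: closed_bigI => i _; apply: closed_le_continuous => u.
      by apply: (@continuousN _ R^o); exact: coord_continuous.
    have sc : continuous (fun u : 'cV[R]_n => \sum_i u i 0).
      by apply: continuous_sum => i; exact: coord_continuous.
    apply: closedI; apply: closed_le_continuous => // u.
    by apply: (@continuousN _ R^o); exact: sc.
  apply/seteqP; split => [u [u0 u1]|u [/= u0 [u1 u1']]].
    split; first by move=> i _ /=; rewrite lerNl oppr0.
    by rewrite /= u1.
  split => [i|]; first by have := u0 i Logic.I; rewrite /= lerNl oppr0.
  by apply/eqP; rewrite eq_le u1 -lerN2.
- exists u^T; last by rewrite trmxK.
  move=> i /=; rewrite mxE in_itv/= u0/= -u1 (bigD1 i)//= lerDl.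
  by apply: sumr_ge0.
Qed.

Lemma continuous_weighted_sum n (r : 'I_n -> R) :
  continuous (fun u : 'cV[R]_n => \sum_i u i 0 * r i).
Proof.
apply: continuous_sum => i u.
by apply: (@continuousM _ _ (fun u : 'cV[R]_n => u i 0) (cst (r i)));
  [exact: coord_continuous|exact: cst_continuous].
Qed.

End SimplexTopology.

(** * The multiplier of the divergence constraint *)

Section Multiplier.
Context {R : realType} (T : nat) (phi : R -> \bar R).
Hypothesis hT : (0 < T)%N.
Hypothesis hphi : divergence_generator phi.
Let phir s := fine (phi s).
Implicit Types (p : 'cV[R]_T) (r : 'I_T -> R).

Let T0 : 0 < T%:R :> R. Proof. by rewrite ltr0n. Qed.

(** The supporting line at [x] is a continuous minorant that touches [phir] there. *)
Lemma generator_lsc_at x : 0 < x -> lsc_at (EFin \o phir) x.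
Proof.
move=> x0 a /=; rewrite lte_fin => ax.
have [k hk] := generator_subgradient hphi x0.
have {}ax : a < k * x + (phir x - k * x) by rewrite addrC subrK.
near=> y; have y0 : 0 < y by near: y; exact: lt_nbhsr.
have : a < k * y + (phir x - k * x).
  by near: y; exact: affine_continuous (lt_nbhsr ax).
by have := hk y y0; rewrite /= lte_fin /phir; lra.
Unshelve. all: by end_near. Qed.

Lemma multiplier_slater (delta : R) r s : 0 < delta ->
  (forall p, ambiguity_set phi delta p -> \sum_j p j 0 * r j <= s) ->
  exists2 lam, 0 <= lam & forall p, simplex p -> (forall j, 0 < p j 0) ->
    \sum_j p j 0 * r j - lam * (fine_divergence phi p - delta) <= s.
Proof.
move=> d0 hs; set u : 'cV[R]_T := uniform T.
have us : simplex u := simplex_uniform hT.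
have u0 : forall j, 0 < u j 0 := uniform_gt0 hT.
have uI : fine_divergence phi u = 0 := fine_divergence_uniform hT hphi.
have ur : \sum_j u j 0 * r j <= s.
  by apply: hs; apply: ambiguity_set_uniform => //; exact: ltW.
(* Points on the axis come from feasible weights. [S] is closed under increasing either coordinate,
   which will fix the sign of the multiplier. *)
pose S := [set ab : R * R | exists p, [/\ simplex p, forall j, 0 < p j 0,
  fine_divergence phi p - delta <= ab.1 & s - \sum_j p j 0 * r j <= ab.2]].
have Su a : - delta <= a -> S (a, s - \sum_j u j 0 * r j).
  by move=> da; exists u; split => //=; rewrite uI; lra.
have [||||k hk] := @convex_support_slope R S.
- move=> a b a' b' t [p [/= sp p0 pa pb]] [p' [/= sp' p'0 pa' pb']] t01.
  have t0 : 0 <= t by case/andP: t01.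
  have t1 : 0 <= 1 - t by case/andP: t01; lra.
  exists (t *: p + (1 - t) *: p'); split => /=.
  + exact: simplex_convex.
  + by move=> j; rewrite !mxE; have := p0 j; have := p'0 j; nra.
  + have := fine_divergence_convex hphi t01
      (pos_fin_num hT hphi p0) (pos_fin_num hT hphi p'0).
    have := ler_wpM2l t0 pa; have := ler_wpM2l t1 pa'; lra.
  + have := ler_wpM2l t0 pb; have := ler_wpM2l t1 pb'.
    rewrite sum_mix; lra.
- move=> b [p [sp p0 /= pd pb]].
  suff : \sum_j p j 0 * r j <= s by lra.
  apply: hs; apply/(ambiguity_setP _ hT hphi); split => //; last by lra.
  exact: pos_fin_num.
- by exists (- delta), (s - \sum_j u j 0 * r j); split; [exact: Su|lra].
- by exists 1, (s - \sum_j u j 0 * r j); split; [apply: Su; lra|lra].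
(* [S] extends to the right without end at the constant height [b], which no line of positive slope
   can stay below. *)
have k0 : k <= 0.
  rewrite leNgt; apply/negP => k0.
  set b := s - \sum_j u j 0 * r j in Su.
  have b0 : 0 <= b by rewrite /b; lra.
  have : k * ((b + 1) / k) <= b.
    apply: hk; apply: Su; apply: (@le_trans _ _ 0); first lra.
    by rewrite divr_ge0 ?ltW//; lra.
  by rewrite mulrC divfK ?gt_eqF//; lra.
exists (- k); first lra.
move=> p sp p0.
have := hk (fine_divergence phi p - delta) (s - \sum_j p j 0 * r j).
by move=> /(_ (ex_intro _ p (And4 sp p0 (lexx _) (lexx _)))); lra.
Qed.

(* Without a Slater point ([delta = 0]) a multiplier exists only up to an
   error: [K] is the compact set of the weights with a value of at least [w],
   and on it the divergence, moved slightly towards the uniform weights, is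
   bounded away from [0]. *)
Lemma multiplier_approx r s w : (forall j, 0 <= r j) -> s < w ->
  (forall p, ambiguity_set phi 0 p -> \sum_j p j 0 * r j <= s) ->
  exists2 lam, 0 <= lam & forall p, simplex p -> (forall j, 0 < p j 0) ->
    \sum_j p j 0 * r j - lam * fine_divergence phi p <= w.
Proof.
move=> r0 sw hs; set u : 'cV[R]_T := uniform T.
have us : simplex u := simplex_uniform hT.
have u0 : forall j, 0 < u j 0 := uniform_gt0 hT.
have uI : fine_divergence phi u = 0 := fine_divergence_uniform hT hphi.
have s0 : 0 <= s.
  apply: le_trans (hs u (ambiguity_set_uniform hT hphi (lexx 0))).
  by apply: sumr_ge0 => j _; rewrite mulr_ge0// ltW.
have w0 : 0 < w by lra.
(* Chosen so that [t * w] is the midpoint of [s] and [w]: weights of value at least [w], mixed with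
   the uniform ones in this proportion, still have value above [s] and thus are infeasible. *)
pose t := (w + s) / (2 * w).
have t0 : 0 < t by rewrite divr_gt0//; lra.
have t1 : t < 1 by rewrite ltr_pdivrMr; lra.
have tw : s < t * w by rewrite /t mulrC mulrA ltr_pdivlMr; nra.
have t01 : 0 <= t <= 1 by lra.
pose q p := t *: p + (1 - t) *: u.
have q0 p : simplex p -> forall j, 0 < q p j 0.
  by move=> [p0 _] j; rewrite !mxE; have := p0 j; have := u0 j; rewrite mxE; nra.
pose K := @simplex R T `&` [set p | \sum_j p j 0 * - r j <= - w].
have cK : compact K.
  apply: compact_closedI; first exact: compact_simplex.
  exact/closed_le_continuous/continuous_weighted_sum.
have sN p : \sum_j p j 0 * - r j = - \sum_j p j 0 * r j.
  by rewrite -sumrN; apply: eq_bigr => j _; rewrite mulrN.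
have [K0|K0] := pselect (K !=set0); last first.
  exists 0 => // p sp p0; rewrite mul0r subr0 leNgt; apply/negP => wp.
  by apply: K0; exists p; split => //=; rewrite sN; lra.
have [|p1 [Kp1 p1min]] :=
    @compact_argmin R _ K (EFin \o (fun p => fine_divergence phi (q p))) cK K0.
  move=> p [sp _].
  rewrite (_ : EFin \o _ = (fun p => \sum_j
      (T%:R^-1)%:E * (phir (T%:R * q p j 0))%:E)%E); last first.
    apply/funext => p' /=; rewrite /fine_divergence mulr_sumr -sumEFin.
    by apply: eq_bigr => j _; rewrite EFinM.
  apply: lsc_at_sum => [j y|j]; first by rewrite -EFinM.
  apply: lsc_atZ; first by rewrite invr_ge0 ler0n.
  apply: (@lsc_at_comp _ _ _ (fun p => T%:R * q p j 0) (EFin \o phir)); last first.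
    by apply: generator_lsc_at; rewrite mulr_gt0// q0.
  rewrite (_ : (fun p' => _) = (fun y => (T%:R * t) * y + T%:R * ((1 - t) * u j 0))
      \o (fun p' : 'cV[R]_T => p' j 0)); last first.
    by apply/funext => p' /=; rewrite !mxE; ring.
  apply: continuous_comp; first exact: coord_continuous.
  exact: affine_continuous.
(* The mixture [q p] has positive weights, which is what made the divergence lower semicontinuous
   and its minimum [m] over [K] attained. *)
set m := fine_divergence phi (q p1) in p1min.
have m0 : 0 < m.
  rewrite ltNge; apply/negP => m0; case: Kp1 => sp1 /=; rewrite sN => wp1.
  have : \sum_j q p1 j 0 * r j <= s.
    apply: hs; apply/(ambiguity_setP _ hT hphi); split => //.
      exact: simplex_convex.
    by apply: pos_fin_num => //; exact: q0.
  rewrite /q sum_mix.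
  have : 0 <= \sum_j u j 0 * r j.
    by apply: sumr_ge0 => j _; rewrite mulr_ge0// ltW.
  nra.
have B0 : 0 <= \sum_j r j by exact: sumr_ge0.
(* On the simplex the value is at most [\sum_j r j], while on [K] the divergence is at least [m]; so
   on [K] the penalty outweighs the value. Off [K] the value is already below [w]. *)
exists ((\sum_j r j) / m); first by rewrite divr_ge0// ltW.
move=> p sp p0; have [wp|pw] := leP w (\sum_j p j 0 * r j); last first.
  have := fine_divergence_ge0 hT hphi sp p0.
  have : 0 <= (\sum_j r j) / m by rewrite divr_ge0// ltW.
  nra.
have Kp : K p by split => //=; rewrite sN; lra.
have := p1min p Kp; rewrite /= lee_fin => mI.
have := fine_divergence_convex hphi t01
      (pos_fin_num hT hphi p0) (pos_fin_num hT hphi u0).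
rewrite uI mulr0 addr0 -/(q p) => qI.
have I0 := fine_divergence_ge0 hT hphi sp p0.
(* By convexity, and as the uniform weights have divergence 0, the divergence of [q p] is at most
   [t] times that of [p]. *)
have mIp : m <= fine_divergence phi p.
  by apply: le_trans mI _; apply: le_trans qI _; rewrite ler_piMl// ltW.
have : \sum_j p j 0 * r j <= \sum_j r j.
  apply: ler_sum => j _; rewrite ler_piMl//; case: sp => sp1 <-.
  by rewrite (bigD1 j)//= lerDl sumr_ge0.
have : (\sum_j r j) / m * m <= (\sum_j r j) / m * fine_divergence phi p.
  by apply: ler_wpM2l => //; rewrite divr_ge0// ltW.
rewrite divfK ?gt_eqF//; lra.
Qed.

End Multiplier.

(** * Weighted sums of extended losses *)

Section WeightedSum.
Context {R : realType} (T : nat).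
Implicit Types (p : 'cV[R]_T) (d : 'I_T -> \bar R).

Lemma weighted_sum_ge0 p d : (forall j, 0 <= p j 0) -> (forall j, 0 <= d j)%E ->
  (0 <= weighted_sum p d)%E.
Proof. by move=> p0 d0; apply: sume_ge0 => j _; rewrite mule_ge0// lee_fin. Qed.

Lemma weighted_sum_pinfty p d j : (forall j, 0 <= p j 0) ->
  (forall j, 0 <= d j)%E -> 0 < p j 0 -> d j = +oo%E ->
  weighted_sum p d = +oo%E.
Proof.
move=> p0 d0 pj dj; apply/esum_eqyP => [i _|].
  by rewrite -ltNye (@lt_le_trans _ _ 0%E)// mule_ge0// lee_fin.
by exists j; split; rewrite ?mem_index_enum// dj gt0_muley.
Qed.

(** A finite sum with positive weights forces every loss to be finite. *)
Lemma weighted_sum_fin_num p p' d : (forall j, 0 < p j 0) ->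
  (forall j, 0 <= p' j 0) -> (forall j, 0 <= d j)%E ->
  weighted_sum p d \is a fin_num -> weighted_sum p' d \is a fin_num.
Proof.
move=> p0 p'0 d0 pd; rewrite sum_fin_num; apply/allP => _ /mapP[j _ ->] /=.
rewrite fin_numM// ge0_fin_numE// ltey; apply/eqP => dj.
move: pd; rewrite (weighted_sum_pinfty _ d0 (p0 j) dj)// => i.
exact: ltW.
Qed.

Lemma weighted_sum_mix p p' d t : 0 <= t <= 1 -> (forall j, 0 <= p j 0) ->
  (forall j, 0 <= p' j 0) -> (forall j, 0 <= d j)%E ->
  weighted_sum (t *: p + (1 - t) *: p') d =
  (t%:E * weighted_sum p d + (1 - t)%:E * weighted_sum p' d)%E.
Proof.
move=> /andP[t0 t1] p0 p'0 d0; have t1' : 0 <= 1 - t by rewrite subr_ge0.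
rewrite /weighted_sum !ge0_sume_distrr; last 2 first.
- by move=> j _; rewrite mule_ge0// lee_fin.
- by move=> j _; rewrite mule_ge0// lee_fin.
rewrite -big_split/=; apply: eq_bigr => j _.
by rewrite !mxE EFinD ge0_muleDl ?lee_fin ?mulr_ge0// !muleA.
Qed.

Lemma le_weighted_sum p d d' : (forall j, 0 <= p j 0) ->
  (forall j, d j <= d' j)%E -> (weighted_sum p d <= weighted_sum p d')%E.
Proof. by move=> p0 dd; apply: lee_sum => j _; rewrite lee_wpmul2l// lee_fin. Qed.

End WeightedSum.

(** * Strong duality, exact for [delta > 0] and approximate in general *)

Section StrongDuality.
Context {R : realType} (T : nat) (phi : R -> \bar R) (delta : R).
Hypothesis hT : (0 < T)%N.
Hypothesis hphi : divergence_generator phi.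
Hypothesis hdelta : 0 <= delta.
Implicit Types (d : 'I_T -> \bar R).

Let P := @ambiguity_set R T phi delta.

Lemma robust_pinfty d j : (forall j, 0 <= d j)%E -> d j = +oo%E ->
  max_value P (weighted_sum ^~ d) = +oo%E.
Proof.
move=> d0 dj; apply/eqP; rewrite eq_le leey /=.
apply: le_max_value_trans (ambiguity_set_uniform hT hphi hdelta) _.
rewrite (weighted_sum_pinfty _ d0 (uniform_gt0 hT j) dj)// => i.
exact/ltW/uniform_gt0.
Qed.

Lemma robust_le_dual_bound d lam xi : 0 <= lam -> (forall j, 0 <= d j)%E ->
  (max_value P (weighted_sum ^~ d) <= dual_bound phi delta d lam xi)%E.
Proof.
by move=> lam0 d0; apply: max_value_le => p Pp; exact: weak_duality.
Qed.

(** Reduces the duality to real losses, an infinite loss being ruled out by [robust_pinfty]. *)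
Lemma finite_losses d : (forall j, 0 <= d j)%E ->
  (max_value P (weighted_sum ^~ d) < +oo)%E ->
  exists r s, [/\ d = EFin \o r, forall j, 0 <= r j,
    max_value P (weighted_sum ^~ d) = s%:E
    & forall p, P p -> \sum_j p j 0 * r j <= s].
Proof.
move=> d0 foo; pose r := fine \o d.
have dr : d = EFin \o r.
  apply/funext => j /=; rewrite fineK// ge0_fin_numE// ltey.
  by apply/eqP => dj; move: foo; rewrite (robust_pinfty d0 dj).
exists r, (fine (max_value P (weighted_sum ^~ d))); split => //.
- by move=> j; rewrite fine_ge0.
- rewrite fineK// ge0_fin_numE//.
  apply: le_max_value_trans (ambiguity_set_uniform hT hphi hdelta) _.
  by apply: weighted_sum_ge0 => // i; exact/ltW/uniform_gt0.
- move=> p Pp; rewrite -lee_fin -weighted_sum_EFin -dr fineK; last first.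
    rewrite ge0_fin_numE//.
    apply: le_max_value_trans (ambiguity_set_uniform hT hphi hdelta) _.
    by apply: weighted_sum_ge0 => // i; exact/ltW/uniform_gt0.
  exact: (@le_max_value _ _ P (weighted_sum ^~ d)).
Qed.

Lemma strong_duality d : 0 < delta -> (forall j, 0 <= d j)%E ->
  exists lam xi, 0 <= lam /\
    dual_bound phi delta d lam xi = max_value P (weighted_sum ^~ d).
Proof.
move=> delta0 d0.
suff [lam [xi [lam0 h]]] : exists lam xi, 0 <= lam /\
    (dual_bound phi delta d lam xi <= max_value P (weighted_sum ^~ d))%E.
  exists lam, xi; split => //; apply/eqP; rewrite eq_le h.
  exact: robust_le_dual_bound.
have [foo|] := ltP (max_value P (weighted_sum ^~ d)) +oo%E; last first.
  by rewrite leye_eq => /eqP ->; exists 0, 0; rewrite leey.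
have [r [s [-> r0 -> hs]]] := finite_losses d0 foo.
have [lam lam0 hlam] := multiplier_slater hT hphi delta0 hs.
have [xi hxi] := dual_bound_of_lagrangian hT hphi lam0 hlam.
by exists lam, xi.
Qed.

Lemma approximate_duality d w : (forall j, 0 <= d j)%E ->
  (max_value P (weighted_sum ^~ d) < w%:E)%E ->
  exists lam xi, 0 <= lam /\ (dual_bound phi delta d lam xi <= w%:E)%E.
Proof.
move=> d0 hw; have [delta0|] := ltP 0 delta.
  have [lam [xi [lam0 E]]] := strong_duality delta0 d0.
  by exists lam, xi; rewrite E; split => //; exact: ltW.
move=> delta0; have {}delta0 : delta = 0 by apply/le_anti/andP.
have foo : (max_value P (weighted_sum ^~ d) < +oo)%E.
  by rewrite (lt_trans hw)// ltry.
have [r [s [dE r0 sE hs]]] := finite_losses d0 foo.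
move: hw; rewrite sE lte_fin => sw; rewrite /P delta0 in hs; rewrite dE delta0.
have [lam lam0 hlam] := multiplier_approx hT hphi r0 sw hs.
have [|xi hxi] := @dual_bound_of_lagrangian _ _ _ 0 hT hphi r lam w lam0.
  by move=> p sp p0; rewrite subr0; exact: hlam.
by exists lam, xi.
Qed.

End StrongDuality.

(** * Risk as a function of the center *)

Section DeviationFunction.
Context {R : realType} (dev : R -> \bar R).
Hypothesis hdev : deviation_function dev.

Lemma deviation_ge0 y : (0 <= dev y)%E.
Proof. by case: hdev. Qed.

(** [y] is a convex combination of [z] and [- z], at which the even function [dev] has the same
    value. *)
Lemma deviation_homo y z : `|y| <= `|z| -> (dev y <= dev z)%E.
Proof.
move=> yz; have [z0|z0] := eqVneq z 0.
  by move: yz; rewrite z0 normr0 normr_le0 => /eqP ->.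
have [_ cvx _ _ even] := hdev.
pose t := (1 + y / z) / 2.
have yz1 : `|y / z| <= 1 by rewrite normrM normfV ler_pdivrMr ?normr_gt0// mul1r.
have /ler_normlP[yz2 yz3] := yz1.
have t01 : 0 <= t <= 1 by rewrite /t; lra.
have := cvx z (- z) t t01.
rewrite (_ : t * z + _ = y); last by rewrite /t; field.
rewrite even -ge0_muleDl ?lee_fin; [|lra|lra].
by rewrite -EFinD addrC subrK mul1e.
Qed.

Variable (T : nat).
Implicit Types (x : 'I_T -> R) (p : 'cV[R]_T) (c : R).

Definition location_risk x c p := weighted_sum p (fun j => dev (x j - c)).

Lemma location_risk_convex x p : (forall j, 0 <= p j 0) ->
  econvex (fun c => location_risk x c p).
Proof.
have [_ cvx _ _ _] := hdev.
move=> p0 c c' t t01; have /andP[t0 t1] := t01.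
have t1' : 0 <= 1 - t by rewrite subr_ge0.
rewrite /location_risk /weighted_sum !ge0_sume_distrr; last 2 first.
- by move=> j _; rewrite mule_ge0 ?lee_fin// deviation_ge0.
- by move=> j _; rewrite mule_ge0 ?lee_fin// deviation_ge0.
rewrite -big_split/=; apply: lee_sum => j _.
rewrite muleCA [X in (_ + X)%E]muleCA -ge0_muleDr.
- rewrite lee_wpmul2l ?lee_fin//.
  by apply: le_trans (cvx (x j - c) (x j - c') t t01); rewrite le_eqVlt; apply/orP;
    left; apply/eqP; congr dev; ring.
- by rewrite mule_ge0 ?lee_fin// deviation_ge0.
- by rewrite mule_ge0 ?lee_fin// deviation_ge0.
Qed.

Lemma location_risk_quasiconvex x p c1 c2 c (b : R) : (forall j, 0 <= p j 0) ->
  c1 <= c <= c2 -> (location_risk x c1 p <= b%:E)%E ->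
  (location_risk x c2 p <= b%:E)%E -> (location_risk x c p <= b%:E)%E.
Proof.
move=> p0 /andP[c1c cc2] h1 h2.
have [c12|c12] := eqVneq c1 c2.
  by rewrite (_ : c = c1)//; apply/le_anti; rewrite c1c c12 cc2.
have D0 : 0 < c2 - c1 by rewrite subr_gt0 lt_neqAle c12 (le_trans c1c).
pose t := (c2 - c) / (c2 - c1).
have t01 : 0 <= t <= 1 by rewrite divr_ge0 ?ler_pdivrMr//=; lra.
have := location_risk_convex x p0 c1 c2 t01.
rewrite (_ : t * c1 + _ = c); last by rewrite /t; field; rewrite gt_eqF.
move=> /le_trans; apply.
rewrite (_ : b%:E = t%:E * b%:E + (1 - t)%:E * b%:E)%E; last first.
  by rewrite -!EFinM -EFinD; congr EFin; ring.
by apply: leeD; apply: lee_wpmul2l => //; rewrite lee_fin; lra.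
Qed.

Definition clip (M c : R) := Num.max (- M) (Num.min M c).

Lemma clip_itv M c : 0 <= M -> `[- M, M]%classic (clip M c).
Proof.
move=> M0; rewrite /= in_itv/= /clip /Num.max /Num.min.
by case: ifPn; case: ifPn => //=; rewrite -?leNgt => *; lra.
Qed.

(** Clipping brings the center closer to each location, and [dev] grows with the distance. *)
Lemma location_risk_clip x p M c : (forall j, 0 <= p j 0) ->
  (forall j, `|x j| <= M) ->
  (location_risk x (clip M c) p <= location_risk x c p)%E.
Proof.
move=> p0 xM; apply: le_weighted_sum => // j; apply: deviation_homo.
have := xM j; rewrite ler_norml => /andP[? ?].
rewrite /clip /Num.max /Num.min.
case: ifPn; case: ifPn => //; rewrite -?leNgt => h1 h2 //; try lra.
- by rewrite !ler0_norm; lra.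
- by rewrite !ler0_norm; lra.
- by rewrite !ger0_norm; lra.
Qed.

Lemma location_risk_lsc x p c : (forall j, 0 <= p j 0) ->
  lsc_at (fun c => location_risk x c p) c.
Proof.
have [_ _ lsc _ _] := hdev.
move=> p0; apply: lsc_at_sum => [j y|j].
  by rewrite -ltNye (@lt_le_trans _ _ 0%E)// mule_ge0 ?lee_fin// deviation_ge0.
apply: lsc_atZ => //; apply: (@lsc_at_comp _ _ _ (fun c => x j - c) dev).
  rewrite (_ : (fun c => _) = (fun y => - 1 * y + x j)); last first.
    by apply/funext => y; ring.
  exact: affine_continuous.
exact: lower_semicontinuous_at.
Qed.

End DeviationFunction.

(** * The minimax theorem *)

Section Minimax.
Context {R : realType} (T : nat) (dev phi : R -> \bar R) (delta : R).
Hypothesis hdev : deviation_function dev.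
Hypothesis hphi : divergence_generator phi.
Hypothesis hT : (0 < T)%N.
Hypothesis hdelta : 0 <= delta.
Implicit Types (x : 'I_T -> R) (p : 'cV[R]_T) (c : R).

Let P := @ambiguity_set R T phi delta.
Let risk := location_risk dev (T := T).

Let P_ge0 p : P p -> forall j, 0 <= p j 0.
Proof. by case=> -[]. Qed.

Let risk_ge0 x c p : P p -> (0 <= risk x c p)%E.
Proof.
by move=> /P_ge0 p0; apply: weighted_sum_ge0 => // j; exact: deviation_ge0.
Qed.

(* By mixing [p] with the uniform weights. *)
Let all_of_positive x c (b : R) :
  (forall p, P p -> (forall j, 0 < p j 0) -> (risk x c p <= b%:E)%E) ->
  forall p, P p -> (risk x c p <= b%:E)%E.
Proof.
move=> h p Pp.
have Pu : P (uniform T) by exact: ambiguity_set_uniform.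
have mix t : 0 < t < 1 -> ((1 - t)%:E * risk x c p <= b%:E)%E.
  move=> t01; have t01' : 0 <= 1 - t <= 1 by lra.
  apply: le_trans (h ((1 - t) *: p + (1 - (1 - t)) *: uniform T) _ _).
  - rewrite /risk /location_risk weighted_sum_mix//; last 3 first.
    + exact: P_ge0.
    + exact: P_ge0.
    + by move=> j; exact: deviation_ge0.
    by rewrite leeDl// mule_ge0 ?risk_ge0// lee_fin; lra.
  - exact: ambiguity_set_convex.
  - move=> j; rewrite !mxE; have := P_ge0 Pp j.
    have : 0 < T%:R^-1 :> R by rewrite invr_gt0 ltr0n.
    nra.
move: mix (risk_ge0 x c Pp); case: (risk x c p) => [a| |]// mix _.
- rewrite lee_fin -subr_ge0; apply: (@ge0_of_small_multiples _ (- a)) => t t01.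
  by have := mix t t01; rewrite -EFinM lee_fin; lra.
- have t01 : 0 < (2^-1 : R) < 1 by lra.
  by have := mix _ t01; rewrite gt0_muley ?lte_fin//; lra.
Qed.

Let bound x := \sum_j `|x j|.

Let bound_ge0 x : 0 <= bound x.
Proof. exact: sumr_ge0. Qed.

Let le_bound x j : `|x j| <= bound x.
Proof. by rewrite /bound (bigD1 j)//= lerDl sumr_ge0. Qed.

Let sublevel x (b : R) p c := `[- bound x, bound x]%classic c /\ (risk x c p <= b%:E)%E.

Let sublevel_clip x b p c : P p -> (risk x c p <= b%:E)%E ->
  sublevel x b p (clip (bound x) c).
Proof.
move=> Pp h; split; first exact: clip_itv.
apply: le_trans h; apply: location_risk_clip => //; exact: P_ge0.
Qed.

(* On the line, closed bounded intervals that intersect pairwise have a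
   common point. *)
Let sublevel_helly x b :
  (forall p, P p -> exists c, sublevel x b p c) ->
  (forall p q, P p -> P q -> (forall j, 0 < p j 0) -> (forall j, 0 < q j 0) ->
     exists c, sublevel x b p c /\ sublevel x b q c) ->
  exists c, forall p, P p -> (risk x c p <= b%:E)%E.
Proof.
move=> ne pw.
have Pu : P (uniform T) by exact: ambiguity_set_uniform.
have u0 : forall j, 0 < (uniform T : 'cV[R]_T) j 0 := uniform_gt0 hT.
(* [sup L] is the supremum of the left ends of the sublevel intervals, the natural candidate for a
   common point. *)
pose L := [set y | exists p, [/\ P p, forall j, 0 < p j 0 &
  forall c, sublevel x b p c -> y <= c]].
have supL : has_sup L.
  split; first by exists (- bound x), (uniform T); split => // c [];
    rewrite /= in_itv/= => /andP[].
  exists (bound x) => y [p [Pp p0 h]]; have [c hc] := ne p Pp.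
  by apply: le_trans (h c hc) _; case: hc; rewrite /= in_itv/= => /andP[].
exists (sup L); apply: all_of_positive => p Pp p0; rewrite leNgt; apply/negP => bl.
(* If the risk of [p] exceeds [b] at [sup L], it does so within some distance [e]; the sublevel of
   [p], being an interval, then lies entirely on one side of this gap. *)
have /nbhs_ballP[e /= e0 he] :=
  location_risk_lsc hdev (P_ge0 Pp) bl.
have {}he c : sublevel x b p c -> c <= sup L - e \/ sup L + e <= c.
  move=> [_ cb]; have [|lc] := leP c (sup L - e); first by left.
  right; rewrite leNgt; apply/negP => cl.
  have /he : ball (sup L) e c by rewrite /ball/= ltr_norml; lra.
  by rewrite /= ltNge cb.
have [[c1 [c1b c1l]]|nc] :=
    pselect (exists c, sublevel x b p c /\ c <= sup L - e).
- have all_le c : sublevel x b p c -> c <= sup L - e.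
    move=> cb; have [//|lc] := he c cb.
    suff : (risk x (sup L) p <= b%:E)%E by rewrite leNgt bl.
    apply: (@location_risk_quasiconvex _ _ hdev _ x p c1 c (sup L) b).
    + exact: P_ge0.
    + by apply/andP; split; lra.
    + exact: c1b.2.
    + exact: cb.2.
  (* Sublevel on the left: some [q] has its own sublevel beyond [sup L - e], hence disjoint from
     that of [p], against [pw]. *)
  have [y [q [Pq q0 hq]] ly] := sup_adherent e0 supL.
  have [c [cp cq]] := pw p q Pp Pq p0 q0.
  by have := hq c cq; have := all_le c cp; lra.
(* Sublevel on the right: [sup L + e] would be one of its lower bounds and so belong to [L]. *)
- have : sup L + e <= sup L.
    apply: ub_le_sup; first exact: supL.2.
    exists p; split => // c cb; have [cl|//] := he c cb.
    by exfalso; apply: nc; exists c.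
  lra.
Qed.

Let combine x (a b : R) p q : a < b -> P p -> P q ->
  (forall j, 0 < p j 0) -> (forall j, 0 < q j 0) ->
  (exists c, risk x c p < a%:E)%E ->
  (forall c, (risk x c p <= b%:E)%E -> (b%:E < risk x c q)%E) ->
  exists2 r, P r & forall c, (b%:E <= risk x c r)%E.
Proof.
move=> ab Pp Pq p0 q0 [c0 c0a] disj.
(* Pairs dominating the excesses of the two risks over [b]. On the axis the first excess is at most
   0, so the second is positive by [disj]; the center [c0] gives a point strictly to the left
   because [a < b]. *)
pose S := [set uv : R * R | exists c,
  (risk x c p <= (b + uv.1)%:E)%E /\ (risk x c q <= (b + uv.2)%:E)%E].
have fin_pq c : risk x c p \is a fin_num -> risk x c q \is a fin_num.
  apply: weighted_sum_fin_num => // [j|j]; first exact: P_ge0.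
  exact: deviation_ge0.
have fin_lt c (w : R) : (risk x c p <= w%:E)%E -> risk x c p \is a fin_num.
  by move=> h; rewrite ge0_fin_numE ?risk_ge0// (le_lt_trans h)// ltry.
have fc0 : risk x c0 q \is a fin_num by apply: fin_pq; apply: fin_lt (ltW c0a).
have S0 u : a - b <= u -> S (u, fine (risk x c0 q) - b).
  move=> au; exists c0 => /=; split; last by rewrite addrC subrK fineK.
  by apply: le_trans (ltW c0a) _; rewrite lee_fin; lra.
have [||||k hk] := @convex_support_slope R S.
- move=> u v u' v' t [c [/= cp cq]] [c' [/= c'p c'q]] t01.
  have /andP[t0 t1] := t01; have t1' : 0 <= 1 - t by lra.
  exists (t * c + (1 - t) * c') => /=; split.
  + apply: le_trans (location_risk_convex hdev x (P_ge0 Pp) c c' t01) _.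
    apply: (@le_trans _ _ (t%:E * (b + u)%:E + (1 - t)%:E * (b + u')%:E)%E).
      by apply: leeD; apply: lee_wpmul2l.
    by rewrite -!EFinM -EFinD lee_fin; lra.
  + apply: le_trans (location_risk_convex hdev x (P_ge0 Pq) c c' t01) _.
    apply: (@le_trans _ _ (t%:E * (b + v)%:E + (1 - t)%:E * (b + v')%:E)%E).
      by apply: leeD; apply: lee_wpmul2l.
    by rewrite -!EFinM -EFinD lee_fin; lra.
- move=> v [c [/=]]; rewrite addr0 => /disj cb cq.
  by have := lt_le_trans cb cq; rewrite lte_fin; lra.
- by exists (a - b), (fine (risk x c0 q) - b); split; [exact: S0|lra].
- by exists 1, (fine (risk x c0 q) - b); split; [apply: S0; lra|lra].
have k0 : k <= 0.
  rewrite leNgt; apply/negP => k0.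
  set v := fine _ - b in S0.
  have : k * ((`|v| + 1) / k) <= v.
    apply: hk; apply: S0; apply: (@le_trans _ _ 0); first lra.
    by rewrite divr_ge0 ?ltW// ltr_wpDl.
  rewrite mulrC divfK ?gt_eqF//; have := ler_norm v; lra.
have D0 : 0 < 1 - k by lra.
(* The normal [(- k, 1)] of the separating line, divided by its sum, gives the mixing
   proportions. *)
pose t := - k / (1 - k).
have t01 : 0 <= t <= 1 by rewrite divr_ge0 ?ler_pdivrMr//=; lra.
exists (t *: p + (1 - t) *: q); first exact: ambiguity_set_convex.
move=> c; have riskE : (risk x c (t *: p + (1 - t) *: q) =
    t%:E * risk x c p + (1 - t)%:E * risk x c q)%E.
  apply: weighted_sum_mix => //; [exact: P_ge0|exact: P_ge0|].
  by move=> j; exact: deviation_ge0.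
have [cp|] := boolP (risk x c p \is a fin_num); last first.
  rewrite ge0_fin_numE ?risk_ge0// -leNgt leye_eq => /eqP cp.
  have cq : risk x c q = +oo%E.
    have [cq|] := boolP (risk x c q \is a fin_num).
      suff : risk x c p \is a fin_num by rewrite cp.
      apply: weighted_sum_fin_num cq => // [j|j]; first exact: P_ge0.
      exact: deviation_ge0.
    by rewrite ge0_fin_numE ?risk_ge0// -leNgt leye_eq => /eqP.
  have t1 : 0 < 1 - t by rewrite subr_gt0 ltr_pdivrMr//; lra.
  rewrite riskE cp cq [X in (_ + X)%E]gt0_muley ?lte_fin// addey ?leey//.
  rewrite -ltNye (@lt_le_trans _ _ 0%E)// mule_ge0// ?lee_fin ?leey//.
  by case/andP: t01.
have cq := fin_pq c cp.
have : k * (fine (risk x c p) - b) <= fine (risk x c q) - b.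
  by apply: hk; exists c => /=; rewrite ![b + _]addrC !subrK !fineK.
rewrite riskE -(fineK cp) -(fineK cq) -!EFinM -EFinD lee_fin => h.
rewrite -subr_ge0 -(pmulr_rge0 _ D0).
rewrite (_ : _ * _ = (fine (risk x c q) - b) - k * (fine (risk x c p) - b)).
  by rewrite subr_ge0.
by rewrite /t; field; rewrite gt_eqF.
Qed.

Lemma minimax_level x (a b : R) : a < b ->
  (forall p, P p -> exists c, risk x c p < a%:E)%E ->
  exists c, forall p, P p -> (risk x c p <= b%:E)%E.
Proof.
move=> ab h; apply: sublevel_helly.
  move=> p Pp; have [c ca] := h p Pp; exists (clip (bound x) c).
  by apply: sublevel_clip => //; apply: ltW; rewrite (lt_trans ca)// lte_fin.
move=> p q Pp Pq p0 q0.
have [[c [cp cq]]|nc] :=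
    pselect (exists c, (risk x c p <= b%:E)%E /\ (risk x c q <= b%:E)%E).
  by exists (clip (bound x) c); split; exact: sublevel_clip.
exfalso; have [|r Pr br] := combine ab Pp Pq p0 q0 (h p Pp).
  by move=> c cp; rewrite ltNge; apply/negP => cq; apply: nc; exists c.
have [c cr] := h r Pr.
by have := le_lt_trans (br c) cr; rewrite lte_fin ltNge ltW.
Qed.

Lemma minimax x :
  max_value P (fun p => min_value setT (fun c => risk x c p)) =
  min_value setT (fun c => max_value P (risk x c)).
Proof.
apply/eqP; rewrite eq_le; apply/andP; split.
  apply: max_value_le => p Pp; apply: le_min_value => c _.
  apply: le_trans (le_max_value _ Pp).
  exact: (@min_value_le _ _ setT (fun c => risk x c p)).
rewrite leNgt; apply/negP => /lte_fin_between[a ha /lte_fin_between[b ab hb]].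
have [p Pp|c hc] := @minimax_level x a b ab.
  have /min_value_lt[c _ ca] :
      (min_value setT (fun c => risk x c p) < a%:E)%E.
    apply: le_lt_trans ha.
    exact: (@le_max_value _ _ P (fun p => min_value setT (fun c => risk x c p))).
  by exists c.
move: hb; rewrite ltNge => /negP; apply.
apply: le_trans (@min_value_le _ _ setT (fun c => max_value P (risk x c)) c Logic.I) _.
exact: max_value_le.
Qed.

(** The set [A] is arbitrary so as to cover both the robust risk and, as a singleton, the risk of
    fixed weights. *)
Lemma argmin_location x (A : set 'cV[R]_T) : A `<=` simplex (n := T) ->
  argmin setT (fun c => max_value A (location_risk dev x c)) !=set0.
Proof.
move=> AS; have A0 p : A p -> forall j, 0 <= p j 0 by move=> /AS[].
have [||c _|c [_ hc]] := @compact_argmin R _ `[- bound x, bound x]%classic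
    (fun c => max_value A (location_risk dev x c)).
- exact: segment_compact.
- by exists (clip (bound x) 0); exact: clip_itv.
- by apply: lsc_at_max_value => p Ap; exact/location_risk_lsc/A0.
exists c; split => // c' _; apply: le_trans (hc _ (clip_itv c' (bound_ge0 x))) _.
apply: max_value_le => p Ap.
apply: le_trans (@le_max_value _ _ A (location_risk dev x c') p Ap).
by apply: location_risk_clip => //; exact: A0.
Qed.

End Minimax.

(** * Worst-case weights for a closed generator *)

Section ClosedAmbiguitySet.
Context {R : realType} (T : nat) (phi : R -> \bar R) (delta : R).
Hypothesis hphi : divergence_generator phi.
Hypothesis hT : (0 < T)%N.
Implicit Types (p : 'cV[R]_T).

Let P := @ambiguity_set R T phi delta.

Lemma compact_ambiguity_set : lower_semicontinuous phi -> compact P.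
Proof.
move=> phil; rewrite /P (_ : ambiguity_set phi delta = @simplex R T `&`
  [set p | divergence phi p (uniform T) <= delta%:E]%E) //.
apply: compact_closedI; first exact: compact_simplex.
rewrite -openC openE => p /= /negP; rewrite -ltNge => hp.
suff dl : lsc_at (fun p : 'cV[R]_T => divergence phi p (uniform T)) p.
  by apply: filterS (dl _ hp) => q hq /=; apply/negP; rewrite -ltNge.
rewrite (_ : (fun _ => _) = (fun p : 'cV[R]_T =>
    \sum_(j < T) (T%:R^-1)%:E * phi (T%:R * p j 0)%R)%E); last first.
  by apply/funext => q; exact: divergence_terms.
apply: lsc_at_sum => [j q|j].
  have := generator_gtNy hphi (T%:R * q j 0).
  by case: (phi _) => // _; rewrite gt0_muley// lte_fin invr_gt0 ltr0n.
apply: lsc_atZ; first by rewrite invr_ge0 ler0n.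
apply: (@lsc_at_comp _ _ _ (fun q : 'cV[R]_T => T%:R * q j 0) phi); last first.
  exact: lower_semicontinuous_at.
rewrite (_ : (fun _ => _) =
    (fun y => T%:R * y + 0) \o (fun q : 'cV[R]_T => q j 0)); last first.
  by apply/funext => q /=; rewrite addr0.
by apply: continuous_comp; [exact: coord_continuous|exact: affine_continuous].
Qed.

Definition swap (j k : 'I_T) p : 'cV[R]_T := \col_i p (tperm j k i) 0.

(** The reference weights are uniform, so the divergence is symmetric in the locations. *)
Lemma ambiguity_set_swap j k p : P p -> P (swap j k p).
Proof.
case=> -[p0 p1] dp; have permI : injective (tperm j k) by exact: perm_inj.
split.
  split => [i|]; first by rewrite mxE.
  by rewrite (reindex_inj permI) -[RHS]p1; apply: eq_bigr => i _; rewrite mxE tpermK.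
apply: le_trans dp; rewrite !divergence_terms (reindex_inj permI)/=.
by rewrite le_eqVlt; apply/orP; left; apply/eqP; apply: eq_bigr => i _;
  rewrite mxE tpermK.
Qed.

Lemma argmax_weighted_sum (d : 'I_T -> \bar R) : 0 <= delta ->
  lower_semicontinuous phi -> (forall j, 0 <= d j)%E ->
  argmax P (weighted_sum ^~ d) !=set0.
Proof.
move=> hdelta phil d0.
have Pu : P (uniform T) by exact: ambiguity_set_uniform.
have [foo|] := ltP (max_value P (weighted_sum ^~ d)) +oo%E; last first.
  rewrite leye_eq => /eqP foo; have [[j dj]|dfin] := pselect (exists j, d j = +oo%E).
    exists (uniform T); split => // p _.
    rewrite (@weighted_sum_pinfty _ _ (uniform T) d j) ?leey//.
      by case: Pu => -[].
    exact: uniform_gt0.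
  exfalso; have dr : d = EFin \o (fine \o d).
    apply/funext => j /=; rewrite fineK// ge0_fin_numE// ltey.
    by apply/eqP => dj; apply: dfin; exists j.
  suff : (max_value P (weighted_sum ^~ d) <= (\sum_j fine (d j))%:E)%E.
    by rewrite foo leNgt ltry.
  apply: max_value_le => p [[p0 p1] _]; rewrite dr weighted_sum_EFin lee_fin.
  apply: ler_sum => j _; rewrite ler_piMl ?fine_ge0//= -p1.
  by rewrite (bigD1 j)//= lerDl sumr_ge0.
have [r [s [-> _ _ _]]] := finite_losses hT hphi hdelta d0 foo.
have [||p _|p [Pp hp]] := @compact_argmin R _ P
    (fun p => (\sum_j p j 0 * - r j)%:E).
- exact: compact_ambiguity_set.
- by exists (uniform T).
- exact: continuous_lsc_at (@continuous_weighted_sum _ _ _ _).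
exists p; split => // q /hp; rewrite !weighted_sum_EFin !lee_fin.
have sN p' : \sum_j p' j 0 * - r j = - \sum_j p' j 0 * r j.
  by rewrite -sumrN; apply: eq_bigr => j _; rewrite mulrN.
by rewrite !sN lerN2.
Qed.

End ClosedAmbiguitySet.

(* The deviation risk is in general not upper semicontinuous in the weights:
   dropping a location enlarges the set of centers of finite risk. A maximizer
   of the risk over the centers [c] that are finite for all locations is
   therefore corrected, by moving weight to the extreme locations, until no
   other center has a smaller risk. *)
Section DeviationRiskMaximizer.
Context {R : realType} (T : nat) (dev phi : R -> \bar R) (delta : R).
Hypothesis hdev : deviation_function dev.
Hypothesis hphi : divergence_generator phi.
Hypothesis hT : (0 < T)%N.
Hypothesis hdelta : 0 <= delta.
Implicit Types (x : 'I_T -> R) (p : 'cV[R]_T) (c : R).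

Let P := @ambiguity_set R T phi delta.
Let risk := location_risk dev (T := T).

Let P_ge0 p : P p -> forall j, 0 <= p j 0.
Proof. by case=> -[]. Qed.

Let risk_ge0 x c p : P p -> (0 <= risk x c p)%E.
Proof.
by move=> /P_ge0 p0; apply: weighted_sum_ge0 => // j; exact: deviation_ge0.
Qed.

(** At such a center the risk is linear in the weights with real coefficients, so the infimum over
    these centers is upper semicontinuous on the ambiguity set. *)
Definition finite_center x c := forall j, (dev (x j - c) < +oo)%E.

Let finite_center_between x c1 c2 c : c1 <= c <= c2 ->
  finite_center x c1 -> finite_center x c2 -> finite_center x c.
Proof.
move=> /andP[c1c cc2] h1 h2 j; have [xc|cx] := leP (x j) c.
  apply: le_lt_trans (h2 j); apply: deviation_homo => //.
  by rewrite !ler0_norm; lra.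
apply: le_lt_trans (h1 j); apply: deviation_homo => //.
by rewrite !ger0_norm; lra.
Qed.

Let not_finite_center x c : ~ finite_center x c -> exists j, dev (x j - c) = +oo%E.
Proof.
by move=> /existsNP[j /negP]; rewrite -leNgt leye_eq => /eqP; exists j.
Qed.

(** A location to the left of [c] is nearer to [c] than to [cbar], so its loss is finite. An
    infinite loss comes from the right, and the rightmost location is at least as far. *)
Let left_infinite x j0 cbar c : (forall j, x j <= x j0) -> finite_center x cbar ->
  c < cbar -> ~ finite_center x c -> dev (x j0 - c) = +oo%E.
Proof.
move=> xj0 hcbar ccbar /not_finite_center[j dj].
have [xc|cx] := leP (x j) c.
  have : (dev (x j - c) <= dev (x j - cbar))%E.
    by apply: deviation_homo => //; rewrite !ler0_norm; lra.
  by rewrite dj leNgt hcbar.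
apply/eqP; rewrite eq_le leey/= -dj; apply: deviation_homo => //.
by have xj := xj0 j; rewrite !ger0_norm; lra.
Qed.

(** The swap only moves the weight of [k] to [j], where the loss is no smaller. *)
Let risk_swap x c j k p : P p -> p j 0 = 0 ->
  (dev (x k - c) <= dev (x j - c))%E -> (risk x c p <= risk x c (swap j k p))%E.
Proof.
move=> Pp pj dkj; have permI : injective (tperm j k) by exact: perm_inj.
rewrite [leRHS](reindex_inj permI)/=; apply: lee_sum => i _.
rewrite mxE tpermK; case: tpermP => [->|->|//]; first by rewrite pj !mul0e.
by rewrite lee_wpmul2l// lee_fin P_ge0.
Qed.

(** A convex function that rises from [c0] to [c1] keeps at least this slope afterwards, so beyond
    [m] it exceeds [V] by an amount independent of [c2]. *)
Let increase x p (V c0 c1 c2 m : R) : P p -> (risk x c0 p < V%:E)%E ->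
  c0 < c1 -> c1 < m -> (V%:E <= risk x c1 p)%E ->
  0 < (m - c1) * (V - fine (risk x c0 p)) / (c1 - c0) /\
  (m < c2 -> ((V + (m - c1) * (V - fine (risk x c0 p)) / (c1 - c0))%:E <=
    risk x c2 p)%E).
Proof.
move=> Pp c0V c01 c1m c1V.
have c0f : risk x c0 p \is a fin_num.
  by rewrite ge0_fin_numE ?risk_ge0// (lt_trans c0V)// ltry.
have AV : fine (risk x c0 p) < V by rewrite -lte_fin fineK.
split; first by rewrite divr_gt0 ?mulr_gt0// subr_gt0.
move=> mc2; have [c2f|] := boolP (risk x c2 p \is a fin_num); last first.
  by rewrite ge0_fin_numE ?risk_ge0// -leNgt leye_eq => /eqP ->; rewrite leey.
pose t := (c2 - c1) / (c2 - c0).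
have t01 : 0 <= t <= 1 by rewrite divr_ge0 ?ler_pdivrMr//=; lra.
have := location_risk_convex hdev x (P_ge0 Pp) c0 c2 t01.
rewrite (_ : t * c0 + _ = c1); last first.
  by rewrite /t; field; rewrite gt_eqF ?subr_gt0 ?(lt_trans c01) ?(lt_trans c1m).
move=> /(le_trans c1V); rewrite -/(risk x c0 p) -/(risk x c2 p).
rewrite -(fineK c0f) -(fineK c2f) -!EFinM -EFinD !lee_fin /=.
set a := fine _ in AV *; set b := fine _ => h.
have D0 : 0 < c1 - c0 by lra.
have D2 : 0 < c2 - c0 by lra.
rewrite -lerBrDl ler_pdivrMr//.
have : (c2 - c0) * V <= (c2 - c1) * a + (c1 - c0) * b.
  have -> : (c2 - c1) * a + (c1 - c0) * b = (c2 - c0) * (t * a + (1 - t) * b).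
    by rewrite /t; field; rewrite gt_eqF.
  by rewrite ler_pM2l.
have : 0 <= (c2 - m) * (V - a) by apply: mulr_ge0; lra.
lra.
Qed.

(** A center [c0] violating the bound has an infinite loss that [p] ignores, so [p] does not charge
    the rightmost location [j0]. Mixing in a little of the swap of [j0] with a charged [k] cures
    this. Where [j0] loses at least as much as [k] the swap does no harm; elsewhere the center lies
    beyond the midpoint [m], and [increase] leaves room for the mixing. *)
Lemma move_weight_right x p (V cbar : R) : P p -> finite_center x cbar ->
  (forall c, finite_center x c -> V%:E <= risk x c p)%E ->
  ~ (forall c, (c < cbar)%R -> V%:E <= risk x c p)%E ->
  exists j0 p', [/\ P p', forall j, 0 < p j 0 -> 0 < p' j 0, 0 < p' j0 0,
    (forall c, finite_center x c -> V%:E <= risk x c p')%E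
    & forall q c, P q -> 0 < q j0 0 -> c < cbar -> ~ finite_center x c ->
        risk x c q = +oo%E].
Proof.
move=> Pp hcbar hV /existsNP[c0 /not_implyP[c0cbar /negP]].
rewrite -ltNge => c0V.
have nc0 : ~ finite_center x c0 by move=> /hV; rewrite leNgt c0V.
have [j0 xj0] : exists j0, forall j, x j <= x j0.
  pose j0 := [arg max_(j > Ordinal hT) x j]%O.
  by exists j0 => j; rewrite /j0; case: arg_maxP => // i _; exact.
have inf_q q c : P q -> 0 < q j0 0 -> c < cbar -> ~ finite_center x c ->
    risk x c q = +oo%E.
  move=> Pq qj0 cc nc; apply: (weighted_sum_pinfty (P_ge0 Pq) _ qj0).
    by move=> j; exact: deviation_ge0.
  exact: left_infinite cc nc.
have pj0 : p j0 0 = 0.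
  apply/eqP; rewrite eq_le P_ge0// andbT leNgt; apply/negP => pj0.
  by move: c0V; rewrite (inf_q p c0)// ltNge leey.
have [k pk] : exists k, 0 < p k 0.
  apply: contrapT => np; case: Pp => -[p0 p1] _.
  have : \sum_i p i 0 = 0.
    apply: big1 => i _; apply/eqP; rewrite eq_le p0 andbT leNgt.
    by apply/negP => pi; apply: np; exists i.
  by rewrite p1 => /eqP; rewrite oner_eq0.
have kj0 : k != j0 by apply: contraTneq pk => ->; rewrite pj0 ltxx.
have Ps := ambiguity_set_swap j0 k Pp.
pose m := (x j0 + x k) / 2.
have loss_m c : (dev (x j0 - c) < dev (x k - c))%E -> m < c.
  move=> h; rewrite ltNge; apply/negP => cm; move: h; rewrite ltNge => /negP; apply.
  apply: deviation_homo => //; have := xj0 k; rewrite /m in cm => xk.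
  rewrite [leRHS]ger0_norm; last lra.
  by rewrite ler_norml; lra.
have [t [t0 t1 ht]] : exists t, [/\ 0 < t, t < 1 & forall c, finite_center x c ->
    (dev (x j0 - c) < dev (x k - c))%E -> (V%:E <= (1 - t)%:E * risk x c p)%E].
  have [[c2 [hc2 c2E]]|nE] := pselect (exists c, finite_center x c /\
      (dev (x j0 - c) < dev (x k - c))%E); last first.
    by exists 2^-1; split; [lra|lra|move=> c hc cE; exfalso; apply: nE; exists c].
  have mc2 := loss_m _ c2E.
  (* The reflection of [c2] in [m]. It is a finite center: locations to its left are nearer to it
     than to [c2], and its distance to [j0] is that of [c2] to [k]. *)
  pose c1 := x j0 + x k - c2.
  have c1m : c1 < m by rewrite /c1 /m in mc2 *; lra.
  have hc1 : finite_center x c1.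
    move=> j; have [xc|cx] := leP (x j) c1.
      apply: le_lt_trans (hc2 j); apply: deviation_homo => //.
      by rewrite !ler0_norm; lra.
    apply: le_lt_trans (hc2 k); apply: deviation_homo => //.
    rewrite ger0_norm; last lra.
    rewrite -normrN; apply: le_trans (ler_norm _).
    by have := xj0 j; rewrite /c1; lra.
  have c01 : c0 < c1.
    rewrite ltNge; apply/negP => c10; apply: nc0.
    by apply: (finite_center_between _ hc1 hcbar); rewrite c10 ltW.
  have [s0 _] := increase c2 Pp c0V c01 c1m (hV _ hc1).
  set s := _ / _ in s0.
  have V0 : 0 < V by rewrite -lte_fin; apply: le_lt_trans c0V; exact: risk_ge0.
  (* With this [t], [(1 - t) * (V + s) = V]. *)
  exists (s / (V + s)); split.
  - by rewrite divr_gt0//; lra.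
  - by rewrite ltr_pdivrMr; lra.
  - move=> c hc cE; have [_ /(_ (loss_m _ cE))] :=
      increase c Pp c0V c01 c1m (hV _ hc1).
    rewrite -/s => h.
    have t1 : 0 <= 1 - s / (V + s) by rewrite subr_ge0 ler_pdivrMr; lra.
    apply: le_trans (lee_wpmul2l _ h); rewrite ?lee_fin//.
    rewrite le_eqVlt; apply/orP; left; apply/eqP.
    by field; rewrite gt_eqF//; lra.
have t01 : 0 <= 1 - t <= 1 by lra.
pose p' := (1 - t) *: p + (1 - (1 - t)) *: swap j0 k p.
have p'E j : p' j 0 = (1 - t) * p j 0 + t * p (tperm j0 k j) 0.
  by rewrite !mxE; ring.
exists j0, p'; split.
- exact: ambiguity_set_convex.
- move=> j pj; rewrite p'E; have := P_ge0 Pp (tperm j0 k j).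
  have t1' : 0 < 1 - t by lra.
  by have := mulr_gt0 t1' pj; nra.
- by rewrite p'E pj0 mulr0 add0r tpermL mulr_gt0.
- move=> c hc; rewrite /risk /location_risk weighted_sum_mix//; last 3 first.
  + exact: P_ge0.
  + exact: P_ge0.
  + by move=> j; exact: deviation_ge0.
  have [le_kj|lt_jk] := leP (dev (x k - c)) (dev (x j0 - c)).
    have le_s := risk_swap Pp pj0 le_kj.
    apply: (le_trans (hV c hc)).
    apply: (@le_trans _ _ ((1 - t)%:E * risk x c p + (1 - (1 - t))%:E * risk x c p)%E).
      rewrite -ge0_muleDl ?lee_fin; [|lra|lra].
      by rewrite -EFinD addrC subrK mul1e.
    by rewrite leeD2l// lee_wpmul2l// lee_fin; lra.
  apply: le_trans (ht c hc lt_jk) _; rewrite leeDl// mule_ge0//.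
    by rewrite lee_fin; lra.
  exact: risk_ge0.
- exact: inf_q.
Qed.

Let risk_opp x c p : risk (fun j => - x j) (- c) p = risk x c p.
Proof.
have [_ _ _ _ even] := hdev.
by apply: eq_bigr => j _; rewrite -opprD even.
Qed.

Let finite_center_opp x c : finite_center (fun j => - x j) (- c) <-> finite_center x c.
Proof.
have [_ _ _ _ even] := hdev.
by split => h j; have := h j; rewrite -opprD even.
Qed.

(** The mirror image of [move_weight_right], under [x -> - x] and [c -> - c]. *)
Lemma move_weight_left x p (V cbar : R) : P p -> finite_center x cbar ->
  (forall c, finite_center x c -> V%:E <= risk x c p)%E ->
  ~ (forall c, (cbar < c)%R -> V%:E <= risk x c p)%E ->
  exists j0 p', [/\ P p', forall j, 0 < p j 0 -> 0 < p' j 0, 0 < p' j0 0,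
    (forall c, finite_center x c -> V%:E <= risk x c p')%E
    & forall q c, P q -> 0 < q j0 0 -> cbar < c -> ~ finite_center x c ->
        risk x c q = +oo%E].
Proof.
move=> Pp hcbar hV nV.
have [|c|h|j0 [p' [Pp' pp' p'j0 hV' hq]]] :=
    @move_weight_right (fun j => - x j) p V (- cbar) Pp.
- exact/finite_center_opp.
- by rewrite -(opprK c) finite_center_opp risk_opp; exact: hV.
- by apply: nV => c cc; rewrite -risk_opp; apply: h; rewrite ltrN2.
exists j0, p'; split => //.
- by move=> c hc; rewrite -risk_opp; apply: hV'; exact/finite_center_opp.
- move=> q c Pq qj0 cc nc; rewrite -risk_opp; apply: hq => //; first by rewrite ltrN2.
  by rewrite finite_center_opp.
Qed.

Lemma argmax_location x : lower_semicontinuous phi ->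
  argmax P (fun p => min_value setT (fun c => risk x c p)) !=set0.
Proof.
move=> phil.
have Pu : P (uniform T) by exact: ambiguity_set_uniform.
have [[cbar hcbar]|nD] := pselect (exists c, finite_center x c); last first.
  exists (uniform T); split => // p _.
  suff -> : min_value setT (fun c => risk x c (uniform T)) = +oo%E by rewrite leey.
  apply/eqP; rewrite eq_le leey/=; apply: le_min_value => c _.
  have [|j dj] := @not_finite_center x c; first by move=> hc; apply: nD; exists c.
  rewrite /risk /location_risk.
  rewrite (weighted_sum_pinfty (P_ge0 Pu) _ (uniform_gt0 hT j) dj)//.
  by move=> i; exact: deviation_ge0.
pose D := finite_center x; pose f p := min_value D (fun c => risk x c p).
have riskE c p : D c -> risk x c p = (\sum_j p j 0 * fine (dev (x j - c)))%:E.
  move=> hc; rewrite -weighted_sum_EFin; apply: eq_bigr => j _ /=.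
  by rewrite fineK// ge0_fin_numE ?deviation_ge0.
have [||p _|p [Pp hp]] := @compact_argmin R _ P (fun p => - f p)%E.
- exact: compact_ambiguity_set.
- by exists (uniform T).
- move=> a; rewrite lteNr -EFinN => /min_value_lt[c Dc].
  rewrite riskE// => hc.
  have := @continuous_lsc_at R _ (fun p : 'cV[R]_T =>
    \sum_j p j 0 * - fine (dev (x j - c))) p (@continuous_weighted_sum _ _ _ _).
  have sN p' : \sum_j p' j 0 * - fine (dev (x j - c)) =
      - \sum_j p' j 0 * fine (dev (x j - c)).
    by rewrite -sumrN; apply: eq_bigr => j _; rewrite mulrN.
  move=> /(_ a); rewrite /= sN lte_fin ltrNr -lte_fin => /(_ hc).
  apply: filterS => q; rewrite sN lte_fin ltrNr -lte_fin => hq.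
  rewrite lteNr -EFinN; apply: le_lt_trans hq; rewrite -riskE//.
  exact: (@min_value_le _ _ D (fun c => risk x c q)).
have fp_fin : f p \is a fin_num.
  rewrite ge0_fin_numE; last by apply: le_min_value => c _; exact: risk_ge0.
  apply: le_lt_trans (@min_value_le _ _ D (fun c => risk x c p) cbar hcbar) _.
  by rewrite riskE// ltry.
pose V := fine (f p).
have VE : V%:E = f p by rewrite fineK.
have hV c : D c -> (V%:E <= risk x c p)%E.
  by rewrite VE; exact: (@min_value_le _ _ D (fun c => risk x c p)).
(* [V] is the largest infimum over the finite centers, hence an upper bound for the infimum over all
   centers at any weights. *)
suff [q Pq hq] : exists2 q, P q & forall c, (V%:E <= risk x c q)%E.
  exists q; split => // q' Pq'.
  apply: (@le_trans _ _ (f q')).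
    apply: le_min_value => c _.
    exact: (@min_value_le _ _ setT (fun c => risk x c q')).
  apply: (@le_trans _ _ V%:E); first by rewrite VE -leeN2 hp.
  by apply: le_min_value => c _.
pose okl q := (forall c, (c < cbar)%R -> V%:E <= risk x c q)%E.
pose okr q := (forall c, (cbar < c)%R -> V%:E <= risk x c q)%E.
have ok q : okl q -> okr q -> (forall c, D c -> V%:E <= risk x c q)%E ->
    forall c, (V%:E <= risk x c q)%E.
  move=> ql qr qD c; case: (ltgtP c cbar) => [/ql //|/qr //|->].
  exact: qD.
have okl_inf j0 q : P q -> 0 < q j0 0 -> (forall c, D c -> V%:E <= risk x c q)%E ->
    (forall q c, P q -> 0 < q j0 0 -> c < cbar -> ~ finite_center x c ->
        risk x c q = +oo%E) -> okl q.
  move=> Pq qj0 qD h c cc; have [/qD //|nc] := pselect (D c).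
  by rewrite (h q c)// leey.
have okr_inf j0 q : P q -> 0 < q j0 0 -> (forall c, D c -> V%:E <= risk x c q)%E ->
    (forall q c, P q -> 0 < q j0 0 -> cbar < c -> ~ finite_center x c ->
        risk x c q = +oo%E) -> okr q.
  move=> Pq qj0 qD h c cc; have [/qD //|nc] := pselect (D c).
  by rewrite (h q c)// leey.
(* At most one correction per side is needed: the second keeps positive weights positive, so the
   extreme location charged by the first stays charged. *)
have [pl|pl] := pselect (okl p).
  have [pr|pr] := pselect (okr p); first by exists p => //; exact: ok.
  have [j1 [p1 [Pp1 pp1 p1j1 p1D h1]]] := move_weight_left Pp hcbar hV pr.
  have p1r : okr p1 by exact: okr_inf h1.
  have [p1l|p1l] := pselect (okl p1); first by exists p1 => //; exact: ok.
  have [j2 [p2 [Pp2 pp2 p2j2 p2D h2]]] := move_weight_right Pp1 hcbar p1D p1l.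
  exists p2 => //; apply: ok => //; first exact: okl_inf h2.
  by apply: okr_inf h1 => //; exact: pp2.
have [j1 [p1 [Pp1 pp1 p1j1 p1D h1]]] := move_weight_right Pp hcbar hV pl.
have p1l : okl p1 by exact: okl_inf h1.
have [p1r|p1r] := pselect (okr p1); first by exists p1 => //; exact: ok.
have [j2 [p2 [Pp2 pp2 p2j2 p2D h2]]] := move_weight_left Pp1 hcbar p1D p1r.
exists p2 => //; apply: ok => //; last exact: okr_inf h2.
by apply: okl_inf h1 => //; exact: pp2.
Qed.

End DeviationRiskMaximizer.

(** * Optimal portfolios of the three problems *)

Section Portfolio.
Context {R : realType} (n T : nat).
Variables (eps : 'I_T -> 'cV[R]_n) (yhat : 'cV[R]_n) (gamma delta : R).
Variables (dev phi : R -> \bar R).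
Hypothesis hn : (0 < n)%N.
Hypothesis hT : (0 < T)%N.
Hypothesis hdelta : 0 <= delta.
Hypothesis hdev : deviation_function dev.
Hypothesis hphi : divergence_generator phi.

Let P : set 'cV[R]_T := ambiguity_set phi delta.
Let Z : set 'cV[R]_n := @simplex R n.
Let F := minimax_objective eps yhat gamma delta dev phi.
Let G := joint_objective eps yhat gamma delta dev phi.
Let H := dual_objective eps yhat gamma delta dev phi.

Lemma dotE (u v : 'cV[R]_n) : dot u v = \sum_i v i 0 * u i 0.
Proof. by rewrite /dot mxE; apply: eq_bigr => i _; rewrite mxE mulrC. Qed.

Lemma dot_continuous (u : 'cV[R]_n) : continuous (dot u).
Proof.
rewrite (_ : dot u = fun v => \sum_i v i 0 * u i 0).
  exact: continuous_weighted_sum.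
by apply/funext => v; exact: dotE.
Qed.

(** Bounds the outcomes of all portfolios at once, so that one compact interval of centers serves
    for every [z]. *)
Let bound := \sum_j \sum_i `|eps j i 0|.

Let bound_ge0 : 0 <= bound.
Proof. by apply: sumr_ge0 => j _; exact: sumr_ge0. Qed.

Let le_bound z j : Z z -> `|dot (eps j) z| <= bound.
Proof.
move=> [z0 z1]; rewrite dotE; apply: le_trans (ler_norm_sum _ _ _) _.
apply: (@le_trans _ _ (\sum_i `|eps j i 0|)).
  apply: ler_sum => i _; rewrite normrM ger0_norm// ler_piMl//.
  by rewrite -z1 (bigD1 i)//= lerDl sumr_ge0.
by rewrite /bound (bigD1 j)//= lerDl sumr_ge0// => i _; exact: sumr_ge0.
Qed.

Lemma deviation_risk_minimax z :
  robust_risk eps delta dev phi z =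
  min_value setT (robust_centered_risk eps delta dev phi z).
Proof. exact: minimax. Qed.

Lemma argmin_robust_centered_risk z :
  argmin setT (robust_centered_risk eps delta dev phi z) !=set0.
Proof.
by apply: (@argmin_location _ _ _ hdev _ P) => p [].
Qed.

Lemma argmin_centered_risk z p : P p ->
  argmin setT (fun c => centered_risk eps dev z c p) !=set0.
Proof.
move=> [sp _]; have [q ->|c [_ hc]] :=
  @argmin_location _ _ _ hdev (fun j => dot (eps j) z) [set p]; first exact: sp.
exists c; split => // c' _; have := hc c' Logic.I.
by rewrite /max_value !image_set1 !ereal_sup1.
Qed.

Let joint_le z c : (F z <= G (z, c))%E.
Proof.
rewrite /F /G /minimax_objective /joint_objective deviation_risk_minimax.
by rewrite leeD2r//; exact: min_value_le.
Qed.

Let joint_attained z : exists c, F z = G (z, c).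
Proof.
have [c hc] := argmin_robust_centered_risk z; exists c.
rewrite /F /G /minimax_objective /joint_objective deviation_risk_minimax.
by rewrite -(argmin_min_value hc).
Qed.

Let joint_le_dual z c lam xi : 0 <= lam -> (G (z, c) <= H (z, c, lam, xi))%E.
Proof.
move=> lam0; rewrite leeD2r//; apply: robust_le_dual_bound => // j.
exact: deviation_ge0.
Qed.

Let dual_near z c (w : R) : (G (z, c) < w%:E)%E ->
  exists lam xi, 0 <= lam /\ (H (z, c, lam, xi) <= w%:E)%E.
Proof.
rewrite /G /joint_objective /H /dual_objective /reward lteBlDr// -EFinD => h.
have [j|lam [xi [lam0 hle]]] := approximate_duality hT hphi hdelta _ h.
  exact: deviation_ge0.
by exists lam, xi; split => //; rewrite leeBlDr// -EFinD.
Qed.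

Let dual_attained z c : 0 < delta ->
  exists lam xi, 0 <= lam /\ H (z, c, lam, xi) = G (z, c).
Proof.
move=> delta0; have [|lam [xi [lam0 E]]] := strong_duality hT hphi hdelta
    (d := fun j => dev (dot (eps j) z - c)) delta0.
  by move=> j; exact: deviation_ge0.
exists lam, xi; split => //.
exact: (congr1 (fun y => (y - reward yhat gamma z)%E) E).
Qed.

(** [G] is jointly lower semicontinuous, as a supremum over the weights minus a continuous reward,
    and clipping confines the center to a compact interval. *)
Lemma argmin_joint : argmin (@joint_feasible R n) G !=set0.
Proof.
pose K := Z `*` `[- bound, bound]%classic.
have cK : compact K.
  by apply: compact_setX; [exact: compact_simplex|exact: segment_compact].
have [||x [Zx hx]] := @compact_argmin R _ K G cK.
- by exists (uniform n, clip bound 0); split; [exact: simplex_uniform|exact: clip_itv].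
- move=> x _.
  rewrite (_ : G = ((fun x => max_value P (fun p =>
      \sum_(j < T) (p j 0%R)%:E * dev (dot (eps j) x.1 - x.2)%R)) \+
      (fun x => (- (gamma * dot yhat x.1))%:E))%E); last first.
    by apply/funext => -[z c]; rewrite /= EFinN.
  apply: lsc_atD => // [y||].
  + rewrite -ltNye; apply: (@lt_le_trans _ _ 0%E) => //.
    apply: le_max_value_trans (ambiguity_set_uniform hT hphi hdelta) _.
    apply: sume_ge0 => j _; apply: mule_ge0; last exact: deviation_ge0.
    by rewrite lee_fin; exact/ltW/uniform_gt0.
  + apply: lsc_at_max_value => p [[p0 _] _].
    apply: lsc_at_sum => [j y|j].
      rewrite -ltNye (@lt_le_trans _ _ 0%E)// mule_ge0 ?lee_fin//.
      exact: deviation_ge0.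
    apply: lsc_atZ => //.
    apply: (@lsc_at_comp _ _ _ (fun x => dot (eps j) x.1 - x.2) dev); last first.
      by apply: lower_semicontinuous_at; case: hdev.
    apply: (@continuousB _ R^o _ (fun x => dot (eps j) x.1) snd).
      by apply: continuous_comp; [exact: cvg_fst|exact: dot_continuous].
    exact: cvg_snd.
  + apply: (@continuous_lsc_at _ _ (fun x => - (gamma * dot yhat x.1))).
    rewrite (_ : (fun _ => _) =
        (fun y => (- gamma) * y + 0) \o (dot yhat \o fst)); last first.
      by apply/funext => y /=; rewrite addr0 mulNr.
    apply: continuous_comp; last exact: affine_continuous.
    by apply: continuous_comp; [exact: cvg_fst|exact: dot_continuous].
case: x Zx hx => z c /= [Zz _] hx; exists (z, c); split => // -[z' c'] Zz'.
apply: le_trans (hx (z', clip bound c') _) _.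
  by split => //; exact: clip_itv.
rewrite leeD2r//; apply: max_value_le => p Pp.
apply: (le_max_value_trans Pp); apply: location_risk_clip => // [|j].
  by case: Pp => -[].
exact: le_bound.
Qed.

(** Equality of values needs multipliers only up to an arbitrarily small error, so [delta = 0] is
    included. *)
Lemma minimax_objective_dual z : Z z ->
  F z = min_value [set x | dual_feasible x /\ x.1.1.1 = z] H.
Proof.
move=> Zz; apply/eqP; rewrite eq_le; apply/andP; split.
  apply: le_min_value => -[[[z' c] lam] xi] [[_ lam0] /= ->].
  exact: le_trans (joint_le z c) (joint_le_dual z c xi lam0).
rewrite leNgt; apply/negP => /lte_fin_between[w].
have [c ->] := joint_attained z => /dual_near[lam [xi [lam0 hle]]].
rewrite ltNge => /negP; apply; apply: le_trans hle.
exact: (@min_value_le _ _ [set x | dual_feasible x /\ x.1.1.1 = z] H (z, c, lam, xi)).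
Qed.

Lemma min_value_joint : min_value Z F = min_value (@joint_feasible R n) G.
Proof.
apply/eqP; rewrite eq_le; apply/andP; split.
  apply: le_min_value => -[z c] Zz; apply: le_trans (joint_le z c).
  exact: min_value_le.
apply: le_min_value => z Zz; have [c ->] := joint_attained z.
exact: min_value_le.
Qed.

Lemma min_value_dual :
  min_value (@joint_feasible R n) G = min_value (@dual_feasible R n) H.
Proof.
apply/eqP; rewrite eq_le; apply/andP; split.
  apply: le_min_value => -[[[z c] lam] xi] [Zz lam0].
  by apply: le_trans (joint_le_dual z c xi lam0); exact: min_value_le.
apply: le_min_value => -[z c] Zz.
rewrite leNgt; apply/negP => /lte_fin_between[w].
move=> /dual_near[lam [xi [lam0 hle]]].
rewrite ltNge => /negP; apply; apply: le_trans hle.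
exact: min_value_le.
Qed.

Lemma argmin_minimaxE :
  argmin Z F = [set z | exists c, argmin (@joint_feasible R n) G (z, c)].
Proof.
apply/seteqP; split => [z [Zz hz]|z [c [Zz hz]]].
  have [c zc] := joint_attained z; exists c; split => // -[z' c'] Zz'.
  by rewrite -zc; apply: le_trans (hz z' Zz') (joint_le z' c').
split => // z' Zz'; have [c' ->] := joint_attained z'.
exact: le_trans (joint_le z c) (hz (z', c') Zz').
Qed.

(** [G (z, c)] is at most the dual value at the minimizer, which is the common optimal value. *)
Lemma argmin_dual_joint z c lam xi :
  argmin (@dual_feasible R n) H (z, c, lam, xi) ->
  argmin (@joint_feasible R n) G (z, c).
Proof.
move=> hx; have [[Zz lam0] _] := hx; split => // y Zy.
apply: le_trans (joint_le_dual z c xi lam0) _.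
by rewrite (argmin_min_value hx) -min_value_dual; exact: min_value_le.
Qed.

Lemma argmin_joint_dual z c : 0 < delta ->
  argmin (@joint_feasible R n) G (z, c) ->
  exists lam xi, argmin (@dual_feasible R n) H (z, c, lam, xi).
Proof.
move=> delta0 hx; have [Zz _] := hx.
have [lam [xi [lam0 E]]] := dual_attained z c delta0.
exists lam, xi; split => // y dy.
by rewrite E (argmin_min_value hx) min_value_dual; exact: min_value_le.
Qed.

End Portfolio.

Theorem mainTheorem1 (R : realType) (n T : nat) (hn : (0 < n)%N)
    (hT : (0 < T)%N) (eps : 'I_T -> 'cV[R]_n) (yhat : 'cV[R]_n)
    (gamma delta : R) (hgamma : 0 <= gamma) (hdelta : 0 <= delta)
    (dev phi : R -> \bar R) (hdev : deviation_function dev)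
    (hphi : divergence_generator phi) :
  let P : set 'cV[R]_T := ambiguity_set phi delta in
  let Z : set 'cV[R]_n := @simplex R n in
  let F := minimax_objective eps yhat gamma delta dev phi in
  let G := joint_objective eps yhat gamma delta dev phi in
  let H := dual_objective eps yhat gamma delta dev phi in
  [/\ (* for each fixed z: max_p f(z, p) = min_c max_p sum_j p_j R(.), with the
         minima over c attained, and the maxima over p too if phi is closed *)
      forall z, Z z ->
        [/\ max_value P (deviation_risk eps dev z)
            = min_value setT (robust_centered_risk eps delta dev phi z),
            argmin setT (robust_centered_risk eps delta dev phi z) !=set0,
            forall p, P p ->
              argmin setT (fun c => centered_risk eps dev z c p) !=set0
          & lower_semicontinuous phi ->
              argmax P (deviation_risk eps dev z) !=set0 /\
              forall c, argmax P (centered_risk eps dev z c) !=set0],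
      (* equality of the optimal values, for each portfolio and overall *)
      forall z, Z z ->
        F z = min_value [set x | dual_feasible x /\ x.1.1.1 = z] H,
      min_value Z F = min_value (@joint_feasible R n) G /\
      min_value (@joint_feasible R n) G = min_value (@dual_feasible R n) H,
      argmin Z F !=set0 /\
      argmin Z F = [set z | exists c, argmin (@joint_feasible R n) G (z, c)]
    & (* for delta > 0 the multipliers exist, and the minimizers correspond *)
      0 < delta ->
        [/\ argmin (@dual_feasible R n) H !=set0,
            argmin Z F = [set z | exists c lam xi,
              argmin (@dual_feasible R n) H (z, c, lam, xi)]
          & argmin (@joint_feasible R n) G = [set x | exists lam xi,
              argmin (@dual_feasible R n) H (x.1, x.2, lam, xi)]]].
Proof.
move=> P Z F G H; split.
- move=> z Zz; split.
  + exact: deviation_risk_minimax.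
  + exact: argmin_robust_centered_risk.
  + exact: argmin_centered_risk.
  + move=> phil; split; first exact: argmax_location.
    by move=> c; apply: argmax_weighted_sum => // j; exact: deviation_ge0.
- exact: minimax_objective_dual.
- by split; [exact: min_value_joint|exact: min_value_dual].
- have [[z c] hx] := argmin_joint eps yhat gamma hn hT hdelta hdev hphi.
  have FE := argmin_minimaxE eps yhat gamma hT hdelta hdev hphi.
  by split => //; exists z; rewrite FE; exists c.
- move=> delta0.
  have [[z c] hx] := argmin_joint eps yhat gamma hn hT hdelta hdev hphi.
  have jd := argmin_joint_dual hT hdelta hdev hphi delta0.
  have dj := argmin_dual_joint hT hdelta hdev hphi.
  split.
  + have [lam [xi h]] := jd _ _ _ _ _ _ hx.
    by exists (z, c, lam, xi).
  + have -> := argmin_minimaxE eps yhat gamma hT hdelta hdev hphi.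
    apply/seteqP; split => [y [c' /jd[lam [xi h]]]|y [c' [lam [xi /dj h]]]].
      by exists c', lam, xi.
    by exists c'.
  + apply/seteqP; split => [[y c'] /jd[lam [xi h]]|[y c'] [lam [xi /dj h]]//].
    by exists lam, xi.
Qed.
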